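(* Fix an integer $\ell\geq 2$. For $n\ge \ell-1$, let $T_n$ be a random recursive tree on $\{0,1,\ldots,n\}$, let $U_1^{(n)},\ldots,U_\ell^{(n)}$ be $\ell$ vertices chosen uniformly at random without replacement from $\{0,1,\ldots,n\}$ (independently of $T_n$), and let $A_{n,2}\le\cdots\le A_{n,\ell}$ be the numbers of steps of the disconnection algorithm for these vertices, as defined in the context. Then, as $n\to\infty$, the random vector $$\left(\frac{\ln n}{n}A_{n,2},\ldots,\frac{\ln n}{n}A_{n,\ell}\right)$$ converges in distribution to $$\left(U_{(1,\ell)},\ldots,U_{(\ell-1,\ell)}\right),$$ where $U_{(1,\ell)}\leq U_{(2,\ell)}\leq\cdots\leq U_{(\ell-1,\ell)}$ denote the first $\ell-1$ order statistics of an i.i.d. sequence $U_1,\ldots,U_\ell$ of uniform $[0,1]$ random variables.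
   Context: An increasing tree on $\{0,1,\ldots,n\}$ is a tree on this vertex set, rooted at $0$, such that the labels increase along the path from the root to any vertex. A random recursive tree (RRT) $T_n$ is a tree picked uniformly at random among all increasing trees on $\{0,1,\ldots,n\}$; equivalently, for $i=1,\ldots,n$ the parent of vertex $i$ is chosen uniformly at random in $\{0,1,\ldots,i-1\}$, independently over $i$. Disconnection algorithm: start from the single component $T_n$, which contains all the $\ell$ distinguished vertices $U_1^{(n)},\ldots,U_\ell^{(n)}$. At each step an edge is chosen uniformly at random among all edges of the components currently kept (given the past, and independently of everything else) and is removed, which splits the component containing it into two subtrees; every emerging component that contains at most one of the $\ell$ distinguished vertices is discarded forever, and the others are kept. The algorithm stops when the $\ell$ distinguished vertices lie in $\ell$ different tree components. For $j=2,\ldots,\ell$, $A_{n,j}$ is the number of steps (edge removals) of this algorithm until, for the first time, the $\ell$ distinguished vertices are spread out over $j$ distinct tree components (discarded components containing a distinguished vertex are counted). Thus $A_{n,2}$ is the first step after which the $\ell$ vertices no longer all belong to the same component, and $A_{n,\ell}$ is the number of steps until they are totally disconnected. *)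

(* Defs.v *)
From mathcomp Require Export all_boot all_order all_algebra.
From mathcomp Require Export all_classical all_reals all_analysis.
Export numFieldNormedType.Exports.
Export Order.TTheory GRing.Theory Num.Theory.

Set Implicit Arguments.
Unset Strict Implicit.
Unset Printing Implicit Defensive.

Global Open Scope classical_set_scope.
Global Open Scope ring_scope.

(* A simple graph on a finite vertex set V is given by its edge set, each edge
   being the two-element set of its end points. *)

Definition adj (V : finType) (E : {set {set V}}) : rel V :=
  [rel x y | [set x; y]%SET \in E].

Definition component (V : finType) (E : {set {set V}}) (x : V) : {set V} :=
  [set y | connect (adj E) x y]%SET.

Definition tree (V : finType) (E : {set {set V}}) : Prop :=
  [/\ (forall e, e \in E -> #|e| = 2%N),
      (forall x y, connect (adj E) x y) &
      (forall c : seq V, (2 < size c)%N -> ~ ucycle (adj E) c)].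

(* The last clause quantifies over all self-avoiding paths issued from the root
   ord0 : in a tree, there is exactly one such path to each vertex. *)
Definition increasing_tree (n : nat) (E : {set {set 'I_n.+1}}) : Prop :=
  tree E /\
  forall p : seq 'I_n.+1, path (adj E) ord0 p -> uniq (ord0 :: p) ->
    sorted (fun i j : 'I_n.+1 => (i < j)%N) (ord0 :: p).

Definition increasing_trees (n : nat) : {set {set {set 'I_n.+1}}} :=
  [set E | `[< increasing_tree E >]]%SET.

(* The forest obtained from t by removing the edges listed in h. *)
Definition remaining (V : finType) (t : {set {set V}}) (h : seq {set V}) :
    {set {set V}} :=
  (t :\: [set e in h])%SET.

(* The edges of the components currently kept, once the edges listed in h have
   been removed from t ; u lists the distinguished vertices. A discarded
   component is never cut again, so that it persists as a component of
   [remaining t h] ; hence the kept components are exactly the components of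
   [remaining t h] with at least two distinguished vertices. *)
Definition kept_edges (V : finType) (l : nat) (t : {set {set V}})
    (u : l.-tuple V) (h : seq {set V}) : {set {set V}} :=
  [set e in remaining t h |
    [exists x in e,
      (1 < #|[set v in u | v \in component (remaining t h) x]|)%N]]%SET.

Definition spread (V : finType) (l : nat) (t : {set {set V}})
    (u : l.-tuple V) (h : seq {set V}) : nat :=
  #|[set component (remaining t h) v | v in u]%SET|.

(* The least k such that removing c 0, ..., c (k - 1) from t spreads u over j
   components. A tree on {0, ..., n} has n edges, so that k <= n for an actual
   run of the algorithm ; the search returns the dummy value n + 1 if there is
   no such k <= n. *)
Definition disconnection_time (n l : nat) (t : {set {set 'I_n.+1}})
    (u : l.-tuple 'I_n.+1) (c : nat -> {set 'I_n.+1}) (j : nat) : nat :=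
  find (fun k => spread t u (mkseq c k) == j) (iota 0 n.+1).

Definition discrete_rv d (Omega : measurableType d) (S : Type)
    (X : Omega -> S) : Prop :=
  forall x, measurable (X @^-1` [set x]).

Definition uniform_on d (Omega : measurableType d) (R : realType)
    (P : probability Omega R) (S : finType) (X : Omega -> S) (A : {set S}) :
    Prop :=
  forall x, P (X @^-1` [set x]) = (if x \in A then #|A|%:R^-1 else 0)%:E.

(* T is a random recursive tree on {0, ..., n}, U an independent uniform
   sample without replacement of l of its vertices, and C k is the edge removed
   at step k + 1 of the disconnection algorithm. In the last clause, the past
   (T, U, C 0, ..., C (k - 1)) takes the value (t, u, h). When no edge is
   kept, the algorithm has stopped, and C k is arbitrary. *)
Record disconnection d (Omega : measurableType d) (R : realType)
    (P : probability Omega R) (n l : nat)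
    (T : Omega -> {set {set 'I_n.+1}}) (U : Omega -> l.-tuple 'I_n.+1)
    (C : nat -> Omega -> {set 'I_n.+1}) : Prop := {
  disconnection_rvT : discrete_rv T ;
  disconnection_rvU : discrete_rv U ;
  disconnection_rvC : forall k, discrete_rv (C k) ;
  disconnection_T : uniform_on P T (increasing_trees n) ;
  disconnection_U : uniform_on P U [set u : l.-tuple 'I_n.+1 | uniq u]%SET ;
  disconnection_TU : forall t u,
    P [set w | T w = t /\ U w = u]
      = (P [set w | T w = t] * P [set w | U w = u])%E ;
  disconnection_C : forall t u k h e, e \in kept_edges t u h ->
    P [set w | [/\ T w = t, U w = u, mkseq (C^~ w) k = h & C k w = e]]
      = (P [set w | [/\ T w = t, U w = u & mkseq (C^~ w) k = h]]
          * (#|kept_edges t u h|%:R^-1)%:E)%E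
}.

Definition mutually_independent d (Omega : measurableType d) (R : realType)
    (P : probability Omega R) (I : finType) (X : I -> {RV P >-> R}) : Prop :=
  forall (J : {set I}) (B : I -> set R), (forall i, measurable (B i)) ->
    P (\bigcap_(i in [set` J]) (X i @^-1` B i))
      = (\prod_(i in J) P (X i @^-1` B i))%E.

Definition iid_uniform01 d (Omega : measurableType d) (R : realType)
    (P : probability Omega R) (I : finType) (X : I -> {RV P >-> R}) : Prop :=
  mutually_independent X /\
  forall i (B : set R), measurable B ->
    distribution P (X i) B = uniform_prob (@ltr01 R) B.

(* The order statistics of x, in increasing order and numbered from 0. *)
Definition order_stat (R : realType) (l : nat) (x : 'I_l -> R) (i : nat) : R :=
  nth 0 (sort <=%R [seq x j | j <- enum 'I_l]) i.

(* The random variables X n may live on different probability spaces. *)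
Definition cvg_in_distribution (R : realType) (S : topologicalType)
    (d : nat -> measure_display) (Omega : forall n, measurableType (d n))
    (P : forall n, probability (Omega n) R) (X : forall n, Omega n -> S)
    d' (Omega' : measurableType d') (P' : probability Omega' R)
    (Y : Omega' -> S) : Prop :=
  forall f : S -> R, continuous f -> (exists M : R, forall x, `|f x| <= M) ->
    ('E_(P n)[f \o X n])%E @[n --> \oo] --> ('E_P'[f \o Y])%E.

(* Main.v *)
Require Import Defs.
From mathcomp Require Import measurable_realfun zify ring lra.

(* A parent function f (f 0 = 0, f i < i) encodes an increasing tree. Cut uniform
   edges of the component of the root: each cut removes a subtree. Given the sets
   removed so far, f i is still uniform on the remaining labels below i, so that
   the component of the root is again a random recursive tree. If it has m
   vertices, the mean size of the next subtree is about ln m and its second moment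
   is at most m. A martingale argument then shows that about (1 - x) n vertices
   remain after x n / ln n cuts: up to an o(1) error, the removal time of a vertex
   multiplied by ln n / n is its rank in the order of removal divided by n.

   The ranks of independent uniform vertices are independent and uniform. When the
   distinguished vertices have distinct removal times, the cuts of the root chain
   are exactly the steps of the disconnection algorithm, and the k-th removal
   separates a single vertex from the others. As this happens with probability
   close to 1, the law of the algorithm is close to the law of the order statistics
   of these ranks. *)

Set Implicit Arguments.
Unset Strict Implicit.
Unset Printing Implicit Defensive.

(** * Increasing trees and parent functions *)

(** No coupling of the algorithm with the root chain is built on [Omega]. The chain exists only
    through finite weighted sums ([chain_mean]), and laws are compared: every run with distinct
    removal times is at least as likely for the algorithm as for the chain with a sample drawn with
    replacement. The algorithm having total mass 1, this one-sided bound controls the total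
    variation by the mass of colliding samples. Conditioning on the past is replaced by an
    involution that swaps the parent of one vertex with another admissible one and preserves the
    weight of the history. For a fixed run of the chain, the ranks permute the vertices. Averages
    over all tuples of vertices are thus exactly those over all tuples of ranks, which discretise
    independent uniform variables. The mesh [N] of the time grid is fixed before [n]. After about n
    / ln n cuts the martingale has variance of order n^2 / ln n, so that a deviation n / (4 N) at
    one of the N + 1 grid times has probability of order N^3 / ln n. This vanishes as n grows; the
    other errors are of order 1 / N. *)

Section ParentFunctions.
Variable n : nat.
Local Notation V := 'I_n.+1.
Implicit Types (f g : {ffun V -> V}) (i v w x y : V).

(** The root is a fixed point, so that ancestors are iterates and [fconnect f w v] means that [v] is
    an ancestor of [w] or [w] itself. *)
Definition parent_fun f : bool :=
  [forall i : V, if i == ord0 then f i == ord0 else (f i < i)%N].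

Lemma parent_fun0 f : parent_fun f -> f ord0 = ord0.
Proof. by move/forallP/(_ ord0); rewrite eqxx => /eqP. Qed.

Lemma parent_fun_lt f i : parent_fun f -> i != ord0 -> (f i < i)%N.
Proof. by move/forallP/(_ i) => + /negbTE i0; rewrite i0. Qed.

Definition edge f v : {set V} := [set v; f v]%SET.

Definition edges f : {set {set V}} := [set edge f v | v in [set~ ord0]]%SET.

Lemma edge_inj f v w : parent_fun f -> v != ord0 -> w != ord0 ->
  edge f v = edge f w -> v = w.
Proof.
move=> pf v0 w0 e; have vl := parent_fun_lt pf v0; have wl := parent_fun_lt pf w0.
have : v \in edge f w by rewrite -e set21.
have : w \in edge f v by rewrite e set21.
rewrite !inE => /orP[/eqP -> //|/eqP wE] /orP[/eqP //|/eqP vE].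
by move: vl wl; rewrite -wE -vE => /ltn_trans h /h; rewrite ltnn.
Qed.

Lemma adj_edges f x y : parent_fun f ->
  adj (edges f) x y = (x != ord0) && (y == f x) || (y != ord0) && (x == f y).
Proof.
move=> pf; rewrite /adj /=; apply/imsetP/orP => [[v]|].
  rewrite !inE => v0 /setP e; have vl := parent_fun_lt pf v0.
  have := e x; have := e y; rewrite !inE !eqxx orbT /=.
  move=> /esym/orP[/eqP yv|/eqP yv] /esym/orP[/eqP xv|/eqP xv].
  - have := e (f v); rewrite !inE eqxx orbT yv xv orbb => /eqP fv.
    by rewrite fv ltnn in vl.
  - by right; rewrite yv v0 xv eqxx.
  - by left; rewrite xv v0 yv eqxx.
  - have := e v; rewrite !inE eqxx /= yv xv orbb => /eqP fv.
    by rewrite -fv ltnn in vl.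
move=> [/andP[x0 /eqP->]|/andP[y0 /eqP->]].
  by exists x; rewrite ?inE.
by exists y; rewrite ?inE // /edge finset.setUC.
Qed.

Lemma adj_edges_lt f x y : parent_fun f -> adj (edges f) x y -> (y < x)%N ->
  y = f x.
Proof.
move=> pf; rewrite adj_edges // => /orP[/andP[_ /eqP] //|/andP[y0 /eqP ->]].
by move=> h; have := ltn_trans h (parent_fun_lt pf y0); rewrite ltnn.
Qed.

Lemma adjC (E : {set {set V}}) x y : adj E x y = adj E y x.
Proof. by rewrite /adj /= finset.setUC. Qed.

Lemma adj_parent f x : parent_fun f -> x != ord0 -> adj (edges f) x (f x).
Proof. by move=> pf x0; rewrite adj_edges // x0 eqxx. Qed.

Lemma edges_inj f g : parent_fun f -> parent_fun g -> edges f = edges g -> f = g.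
Proof.
move=> pf pg e; apply/ffunP => i; have [->|i0] := eqVneq i ord0.
  by rewrite !parent_fun0.
apply: esym; apply: (adj_edges_lt pf); last exact: parent_fun_lt.
by rewrite e; exact: adj_parent.
Qed.

(** A self-avoiding path that does not climb at its first step goes to a child; the parent of that
    child has just been visited, so the path can never climb later. *)
Lemma parent_path_sorted f x p : parent_fun f ->
  path (adj (edges f)) x p -> uniq (x :: p) -> f x \notin p ->
  sorted (fun i j : V => (i < j)%N) (x :: p).
Proof.
move=> pf; elim: p x => //= y p IH x /andP[xy yp] /andP[xp yup].
rewrite inE negb_or => /andP[yfx fxp].
have ltxy : (x < y)%N.
  rewrite ltnNge; apply/negP => le_yx.
  have lt_yx : (y < x)%N.
    by rewrite ltn_neqAle le_yx andbT; apply: contraNneq xp => /val_inj ->;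
       rewrite mem_head.
  by move: yfx; rewrite (adj_edges_lt pf xy lt_yx) eqxx.
rewrite ltxy /=; apply: IH => //.
rewrite adjC in xy; rewrite -(adj_edges_lt pf xy ltxy).
by apply: contra xp => xp; rewrite inE xp orbT.
Qed.

Lemma connect_edges0 f x : parent_fun f -> connect (adj (edges f)) x ord0.
Proof.
move=> pf; have [m] := ubnP x; elim: m x => // m IH x xm.
have [->//|x0] := eqVneq x ord0.
apply: connect_trans (connect1 (adj_parent pf x0)) (IH _ _).
exact: leq_trans (parent_fun_lt pf x0) xm.
Qed.

Lemma edges_increasing_tree f : parent_fun f -> increasing_tree (edges f).
Proof.
move=> pf; split; last first.
  move=> p hp up; apply: (parent_path_sorted pf) => //.
  by rewrite parent_fun0 //; case/andP: up.
have adj_sym : connect_sym (adj (edges f)).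
  by apply: sym_connect_sym => x y; exact: adjC.
split.
- move=> e /imsetP[v]; rewrite !inE => v0 ->.
  rewrite cards2; suff -> : v != f v by [].
  by apply/eqP => e'; have := parent_fun_lt pf v0; rewrite -e' ltnn.
- move=> x y; apply: connect_trans (connect_edges0 x pf) _.
  by rewrite adj_sym; exact: connect_edges0.
move=> c cs /andP[cc uc].
(* Both neighbours of the largest label on the cycle are smaller than it, hence both equal to its
   parent. *)
have [x xc xmax] : exists2 x, x \in c & forall y, y \in c -> (y <= x)%N.
  case: c cs cc uc => // a c _ _ _.
  have a_in : a \in a :: c by rewrite mem_head.
  by case: (arg_maxnP (fun y : V => val y) a_in) => x xc xm; exists x.
have [k s sE] := rot_to xc.
have uS : uniq (x :: s) by rewrite -sE rot_uniq.
have cS : cycle (adj (edges f)) (x :: s) by rewrite -sE rot_cycle.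
have sz : size (x :: s) = size c by rewrite -sE size_rot.
have sub y : y \in x :: s -> y \in c by rewrite -sE mem_rot.
case: s {sE} uS cS sz sub => [|y s] uS cS sz sub; first by rewrite -sz in cs.
case/lastP: s uS cS sz sub => [|s z] uS cS sz sub; first by rewrite -sz in cs.
have lt_of w : w \in y :: rcons s z -> (w < x)%N.
  move=> ws; have wx : (w <= x)%N by apply/xmax/sub; rewrite inE ws orbT.
  rewrite ltn_neqAle wx andbT.
  by apply: contraTneq uS => /val_inj <-; rewrite cons_uniq ws.
have z_in : z \in y :: rcons s z by rewrite inE mem_rcons mem_head orbT.
have y_in : y \in y :: rcons s z by rewrite mem_head.
move: cS => /=; rewrite rcons_path last_rcons => /andP[xy /andP[_ zx]].
rewrite adjC in zx.
have := adj_edges_lt pf xy (lt_of _ y_in).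
rewrite -(adj_edges_lt pf zx (lt_of _ z_in)) => yz.
by move: uS; rewrite yz /= mem_rcons mem_head /= andbF.
Qed.

(** * Every increasing tree comes from a parent function *)

Section IncreasingTree.
Variable t : {set {set V}}.
Hypothesis it : increasing_tree t.

Let root_path i : exists p, [/\ path (adj t) ord0 p, uniq (ord0 :: p),
  last ord0 p = i & forall j, j \in ord0 :: p -> (j <= i)%N].
Proof.
case: it => -[_ /(_ ord0 i)/connectP[p0 hp0 ->] _] hs.
case/shortenP: hp0 => p hp up _; exists p; split=> //.
have tr : transitive (fun i j : V => (i < j)%N) by move=> ? ? ?; exact: ltn_trans.
have := hs p hp up; rewrite (sorted_pairwise tr).
case/lastP: p hp up => [|p z] hp up.
  by move=> _ j; rewrite inE => /eqP ->.
rewrite last_rcons -rcons_cons pairwise_rcons => /andP[/allP pz _] j.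
by rewrite mem_rcons inE => /orP[/eqP -> //|/pz /ltnW].
Qed.

(** The path from the root to [k] has labels at most [k], hence avoids [i] and [j]. Extended by [i]
    and then [j], it is self-avoiding but decreases at its last step. *)
Let smaller_neighbour_uniq_lt i j k : adj t i j -> adj t i k ->
  (j < i)%N -> (k < i)%N -> (k < j)%N -> False.
Proof.
move=> ij ik ji ki kj; case: it => _ hs.
have [p [hp up pl pm]] := root_path k.
have big (l : V) : (k < l)%N -> l \notin ord0 :: p.
  by move=> kl; apply: contraL kl => /pm; rewrite -leqNgt.
have := hs (rcons (rcons p i) j).
rewrite !rcons_path hp pl last_rcons adjC ik ij -!rcons_cons !rcons_uniq up.
have iNj : j != i by apply: contraTneq ji => ->; rewrite ltnn.
rewrite mem_rcons inE negb_or iNj !big // => /(_ isT isT).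
rewrite /sorted /= -cats1 -cats1 !cat_path /= => /andP[_].
by rewrite cats1 last_rcons andbT => /(ltn_trans ji); rewrite ltnn.
Qed.

Lemma smaller_neighbour_uniq i j k : adj t i j -> adj t i k ->
  (j < i)%N -> (k < i)%N -> j = k.
Proof.
move=> ij ik ji ki; case: (ltngtP j k) => [jk|kj|/val_inj //]; exfalso.
- exact: smaller_neighbour_uniq_lt ik ij ki ji jk.
- exact: smaller_neighbour_uniq_lt ij ik ji ki kj.
Qed.

Lemma smaller_neighbour_ex i : i != ord0 -> exists2 j, adj t i j & (j < i)%N.
Proof.
move=> i0; have [p [hp up pl pm]] := root_path i.
case/lastP: p hp up pl pm => [|p z] hp up; rewrite ?last_rcons => /= pl pm.
  by rewrite pl eqxx in i0.
move: hp; rewrite rcons_path pl => /andP[_ e]; exists (last ord0 p).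
  by rewrite adjC.
rewrite ltn_neqAle pm ?andbT; last first.
  by rewrite -rcons_cons mem_rcons inE mem_last orbT.
apply: contraTneq up => /val_inj lpi.
by rewrite -rcons_cons rcons_uniq -[X in X \notin _]/z pl -lpi mem_last.
Qed.

Lemma increasing_tree_edges : exists2 f, parent_fun f & t = edges f.
Proof.
pose f := [ffun i : V => odflt ord0 [pick j | adj t i j && (j < i)%N]].
have fP i : i != ord0 -> adj t i (f i) /\ (f i < i)%N.
  move=> i0; rewrite ffunE; case: pickP => [j /andP[] //|] h.
  have [j ij ji] := smaller_neighbour_ex i0.
  by have := h j; rewrite ij ji.
have pf : parent_fun f.
  apply/forallP => i; case: ifPn => [/eqP ->|/fP[] //].
  by rewrite ffunE; case: pickP => // j; rewrite andbF.
have edgeP x y : adj t x y -> (y < x)%N -> [set x; y]%SET \in edges f.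
  move=> xy yx; have x0 : x != ord0 by apply: contraTneq yx => ->.
  have [h1 h2] := fP x x0.
  rewrite (smaller_neighbour_uniq xy h1 yx h2).
  by apply/imsetP; exists x; rewrite ?inE.
exists f => //; apply/setP => e; apply/idP/idP => [et|/imsetP[v]].
  have [x [y [xy eE]]] : exists x y, x != y /\ e = [set x; y]%SET.
    by case: it => -[h _ _] _; apply/cards2P/eqP/h.
  move: et; rewrite eE => et.
  case: (ltngtP x y) => [ltxy|ltyx|/val_inj exy].
  - by rewrite finset.setUC; apply: edgeP; rewrite 1?adjC.
  - exact: edgeP.
  - by rewrite exy eqxx in xy.
by rewrite !inE => /fP[h _] ->.
Qed.

End IncreasingTree.

Lemma increasing_treesE :
  increasing_trees n = [set edges f | f in [set f | parent_fun f]]%SET.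
Proof.
apply/setP => t; rewrite inE; apply/asboolP/imsetP => [it|[f]].
  by have [f pf ->] := increasing_tree_edges it; exists f; rewrite ?inE.
by rewrite inE => pf ->; exact: edges_increasing_tree.
Qed.

Lemma card_increasing_trees :
  #|increasing_trees n| = #|[set f | parent_fun f]%SET|.
Proof.
rewrite increasing_treesE card_in_imset // => f g.
by rewrite !inE => pf pg; exact: edges_inj.
Qed.

Lemma parent_fun_ex : exists f, parent_fun f.
Proof.
exists [ffun=> ord0]; apply/forallP => i; rewrite ffunE eqxx.
by case: ifPn => //; rewrite -lt0n.
Qed.

End ParentFunctions.

(** * The component of the root *)

Section RootComponent.
Variable n : nat.
Local Notation V := 'I_n.+1.
Implicit Types (f g : {ffun V -> V}) (v w x y : V) (h s : seq V).

(** The subtree of [v] in the initial tree, whatever was detached before. It is empty at the root,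
    so that a dummy cut there changes nothing. *)
Definition cut f v : {set V} := [set w | (v != ord0) && fconnect f w v]%SET.

Definition alive f h : {set V} :=
  [set w | ~~ has (fun v => w \in cut f v) h]%SET.

(** By the default value of [find], a vertex that is still alive has removal time [size h]. *)
Definition removal_time f h w : nat := find (fun v => w \in cut f v) h.

(** The vertex of smallest label in the current component of [w] when [root_cuts f h] holds; the
    default value of [nth] gives the root for the vertices still alive. *)
Definition top f h w : V := nth ord0 h (removal_time f h w).

Lemma fconnectE f w v : fconnect f w v = (w == v) || fconnect f (f w) v.
Proof.
apply/idP/orP => [|[/eqP ->//|]].
  move=> /iter_findex; case: (findex f w v) => [/= ->|m]; first by left.
  by rewrite iterSr => <-; right; exact: fconnect_iter.
by apply: connect_trans; exact: fconnect1.
Qed.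

Lemma cut0 f : cut f ord0 = finset.set0.
Proof. by apply/setP => w; rewrite !inE eqxx. Qed.

Lemma cut_refl f v : v != ord0 -> v \in cut f v.
Proof. by move=> v0; rewrite inE v0 connect0. Qed.

Lemma cutE f w v : (w \in cut f v) = (v != ord0) && ((w == v) || (f w \in cut f v)).
Proof. by rewrite !inE fconnectE; case: (v != ord0). Qed.

Lemma cut_parent f w v : w != v -> (w \in cut f v) = (f w \in cut f v).
Proof. by rewrite cutE => /negbTE ->; rewrite inE; case: (v != ord0). Qed.

Lemma notin_cut0 f v : parent_fun f -> ord0 \notin cut f v.
Proof.
move=> pf; rewrite inE; apply/negP => /andP[v0 /iter_findex].
by rewrite iter_fix ?parent_fun0 // => e; rewrite e eqxx in v0.
Qed.

Lemma cut_le f w v : parent_fun f -> w \in cut f v -> (v <= w)%N.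
Proof.
move=> pf; have [m] := ubnP w; elim: m w => // m IH w wm.
rewrite cutE => /andP[v0 /orP[/eqP -> //|fw]].
have [w0|w0] := eqVneq w ord0.
  by move: fw; rewrite w0 parent_fun0 // (negbTE (notin_cut0 v pf)).
have fwl := parent_fun_lt pf w0.
apply: leq_trans (IH _ _ fw) (ltnW fwl).
exact: leq_trans fwl wm.
Qed.

Lemma ord0_alive f h : parent_fun f -> ord0 \in alive f h.
Proof. by move=> pf; rewrite inE; apply/hasPn => v _; exact: notin_cut0. Qed.

Lemma removal_time_le f h w : (removal_time f h w <= size h)%N.
Proof. exact: find_size. Qed.

Lemma aliveE f h w : (w \in alive f h) = (removal_time f h w == size h).
Proof. by rewrite inE has_find eqn_leq find_size -leqNgt. Qed.

Lemma alive_cons f v s : alive f (v :: s) = (alive f s :\: cut f v)%SET.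
Proof. by apply/setP => w; rewrite !inE /= !inE negb_or. Qed.

Lemma alive_nil f : alive f [::] = [set: V]%SET.
Proof. by apply/setP => w; rewrite !inE. Qed.

Lemma alive_rev f h : alive f (rev h) = alive f h.
Proof. by apply/setP => w; rewrite !inE has_rev. Qed.

Lemma removal_time_take f h k w : (k <= size h)%N ->
  removal_time f (take k h) w = minn (removal_time f h w) k.
Proof.
move=> kh; rewrite /removal_time -{2}(cat_take_drop k h) find_cat.
case: ifPn => hk.
  by rewrite (minn_idPl _) // ltnW // -[X in (_ < X)%N](size_takel kh) -has_find.
by rewrite hasNfind // size_takel // (minn_idPr _) // leq_addr.
Qed.

Lemma alive_take f h k w : (k <= size h)%N ->
  (w \in alive f (take k h)) = (k <= removal_time f h w)%N.
Proof.
move=> kh; rewrite aliveE removal_time_take // size_takel //.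
by apply/eqP/idP => /minn_idPr.
Qed.

(** Here the oldest cut comes first, as in the algorithm; histories of the chain are reversed before
    being used as such a list. *)
Definition root_cuts f h : Prop := forall i, (i < size h)%N ->
  nth ord0 h i != ord0 /\ nth ord0 h i \in alive f (take i h).

Section RootCuts.
Variables (f : {ffun V -> V}) (h : seq V).
Hypotheses (pf : parent_fun f) (rh : root_cuts f h).

Lemma removal_time_nth i : (i < size h)%N -> removal_time f h (nth ord0 h i) = i.
Proof.
move=> ih; have [h0] := rh ih; rewrite alive_take ?(ltnW ih) // => le_i.
apply/eqP; rewrite eqn_leq le_i andbT leqNgt; apply/negP => lt_i.
by have := before_find ord0 lt_i; rewrite cut_refl.
Qed.

Lemma root_cuts_uniq : uniq h.
Proof.
apply/(uniqP ord0) => i j; rewrite !inE => ih jh e.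
by rewrite -(removal_time_nth ih) -(removal_time_nth jh) e.
Qed.

Lemma top_eq x y : (top f h x == top f h y)
  = (removal_time f h x == removal_time f h y).
Proof.
have nth0 i : (i < size h)%N -> nth ord0 h i != ord0 by move=> /rh[].
apply/idP/eqP => [|e]; last by rewrite /top e.
rewrite /top; have := removal_time_le f h x; have := removal_time_le f h y.
case: (ltngtP (removal_time f h y) (size h)) => // yh _;
  case: (ltngtP (removal_time f h x) (size h)) => // xh _.
- by rewrite nth_uniq ?root_cuts_uniq // => /eqP.
- by rewrite xh nth_default // eq_sym (negbTE (nth0 _ yh)).
- by rewrite yh [X in _ == X]nth_default // (negbTE (nth0 _ xh)).
- by rewrite xh yh.
Qed.

Lemma top_eq0 x : (top f h x == ord0) = (x \in alive f h).
Proof.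
rewrite aliveE /top; have := removal_time_le f h x; rewrite leq_eqVlt.
case/orP => [/eqP ->|xh]; first by rewrite nth_default ?eqxx.
by rewrite (ltn_eqF xh) (negbTE (rh xh).1).
Qed.

Lemma top_mem x : x \in h -> top f h x = x.
Proof.
move=> xh; have ih : (index x h < size h)%N by rewrite index_mem.
have := removal_time_nth ih; rewrite nth_index // /top => ->.
by rewrite nth_index.
Qed.

(** The edge from [x] to its parent is not cut: any subtree cut off contains both ends or
    neither. *)
Lemma top_parent x : x \notin h -> top f h (f x) = top f h x.
Proof.
move=> xh; rewrite /top /removal_time; congr nth; apply: eq_in_find => v vh.
by rewrite [RHS]cut_parent //; apply: contraNneq xh => ->.
Qed.

Lemma mem_remaining e : reflect
  (exists2 v, (v != ord0) && (v \notin h) & e = edge f v)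
  (e \in remaining (edges f) (map (edge f) h)).
Proof.
apply: (iffP idP) => [|[v /andP[v0 vh] ->]].
  rewrite !inE => /andP[eh /imsetP[v]]; rewrite !inE => v0 eE.
  by exists v => //; rewrite v0; apply: contra eh => vh; rewrite eE map_f.
rewrite !inE; apply/andP; split; last by apply/imsetP; exists v; rewrite ?inE.
apply/mapP => -[w wh] /(edge_inj pf v0) vw.
have w0 : w != ord0.
  by have := rh (i := index w h); rewrite index_mem nth_index // => /(_ wh)[].
by rewrite (vw w0) wh in vh.
Qed.

(** Crossing a remaining edge preserves [top], and conversely climbing from parent to parent along
    remaining edges leads to [top]. *)
Lemma connect_remaining x y :
  connect (adj (remaining (edges f) (map (edge f) h))) x y
  = (top f h x == top f h y).
Proof.
set a := adj _; have asym : connect_sym a.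
  by apply: sym_connect_sym => ? ?; exact: adjC.
have adjP z : z != ord0 -> z \notin h -> a z (f z).
  by move=> z0 zh; apply/mem_remaining; exists z; rewrite ?z0.
apply/idP/eqP.
  case/connectP => p; elim: p x => [x _ -> //|z p IH x /= /andP[xz zp] lz].
  rewrite -(IH z) //; move: xz => /mem_remaining[v /andP[v0 vh] /setP e].
  have := e x; have := e z; rewrite !inE !eqxx orbT /=.
  by move=> /esym/orP[]/eqP-> /esym/orP[]/eqP->; rewrite ?top_parent.
have to_top z : connect a z (top f h z).
  have [m] := ubnP z; elim: m z => // m IH z zm.
  have [->|z0] := eqVneq z ord0.
    by have := ord0_alive h pf; rewrite -top_eq0 => /eqP ->.
  have [zh|zh] := boolP (z \in h); first by rewrite top_mem.
  apply: connect_trans (connect1 (adjP _ z0 zh)) _.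
  rewrite -top_parent //; apply: IH; exact: leq_trans (parent_fun_lt pf z0) zm.
move=> e; apply: connect_trans (to_top x) _; rewrite e asym; exact: to_top.
Qed.

Lemma component_remaining x :
  component (remaining (edges f) (map (edge f) h)) x
  = [set y | removal_time f h y == removal_time f h x]%SET.
Proof.
by apply/setP => y; rewrite !inE connect_remaining top_eq eq_sym.
Qed.

End RootCuts.

Lemma root_cuts_take f h k : root_cuts f h -> root_cuts f (take k h).
Proof.
move=> rh i; rewrite size_take_min leq_min => /andP[ik ih].
by rewrite nth_take // take_takel ?(ltnW ik) //; exact: rh.
Qed.

Lemma card_imset_undup (T : finType) (m : nat) (u : m.-tuple V) (F : V -> T)
    (G : V -> nat) :
  (forall v w, (F v == F w) = (G v == G w)) ->
  #|[set F v | v in u]%SET| = size (undup [seq G v | v <- u]).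
Proof.
move=> FG; have -> : [set F v | v in u]%SET = [set x in [seq F v | v <- u]]%SET.
  by apply/setP => x; rewrite inE; apply/imsetP/mapP => -[v vu ->]; exists v.
rewrite cardsE; have := card_uniqP (undup_uniq [seq F v | v <- u]).
rewrite (eq_card (mem_undup _)) => ->.
elim: (val u) => //= a s IH.
have -> : (F a \in [seq F v | v <- s]) = (G a \in [seq G v | v <- s]).
  by apply/mapP/mapP => -[w ws /eqP]; [rewrite FG|rewrite -FG] => /eqP ?; exists w.
by case: ifP => //= _; rewrite IH.
Qed.

(** Truncation at [k] keeps the entries below [k] distinct and merges all the others into one
    value. *)
Lemma size_undup_minn (s : seq nat) k : uniq s ->
  size (undup [seq minn x k | x : nat <- s])
  = (count (fun x : nat => x < k)%N s + has (fun x : nat => k <= x)%N s)%N.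
Proof.
elim: s => //= a s IH /andP[nas us]; case: (ltnP a k) => ak.
  have -> : (a \in [seq minn x k | x : nat <- s]) = false.
    apply/negP => /mapP[b bs]; case: (ltnP b k) => bk e.
      by rewrite e bs in nas.
    by rewrite e ltnn in ak.
  by rewrite /= IH.
have -> : (k \in [seq minn x k | x : nat <- s]) = has (fun x : nat => k <= x)%N s.
  apply/mapP/hasP => -[b bs].
    by move=> e; exists b => //; rewrite e geq_minl.
  by move=> kb; exists b => //; rewrite (minn_idPr kb).
by case: ifP => hs; rewrite /= IH // hs ?addn0 ?addn1.
Qed.

(** With distinct removal times, each removed distinguished vertex is alone in its component, and
    those still alive share the component of the root. *)
Lemma spread_take f h (l : nat) (u : l.-tuple V) k : parent_fun f ->
  root_cuts f h -> uniq (map (removal_time f h) u) -> (k <= size h)%N ->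
  spread (edges f) u (map (edge f) (take k h))
  = (count (fun v => removal_time f h v < k)%N u
     + has (fun v => k <= removal_time f h v)%N u)%N.
Proof.
move=> pf rh uu kh; have rk := root_cuts_take (k := k) rh.
rewrite /spread (card_imset_undup _ (G := removal_time f (take k h))); last first.
  move=> v w; rewrite !component_remaining //; apply/eqP/eqP => [/setP/(_ v)|-> //].
  by rewrite !inE eqxx => /esym/eqP.
have := size_undup_minn k uu; rewrite -map_comp count_map has_map => <-.
by congr (size (undup _)); apply: eq_map => v /=; rewrite removal_time_take.
Qed.

Lemma disconnection_timeE f h (l : nat) (u : l.-tuple V) c i : parent_fun f ->
  root_cuts f h -> uniq (map (removal_time f h) u) -> (size h <= n)%N ->
  mkseq c (size h) = map (edge f) h ->
  let m := nth 0%N (sort leq (map (removal_time f h) u)) i in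
  (i.+1 < l)%N -> (m < size h)%N ->
  disconnection_time (edges f) u c i.+2 = m.+1.
Proof.
move=> pf rh uu hn hc; set s := sort _ _ => m il mh.
have cE k : (k <= size h)%N -> mkseq c k = map (edge f) (take k h).
  by move=> kh; rewrite map_take -hc /mkseq -map_take take_iota (minn_idPl kh).
have us : uniq s by rewrite sort_uniq.
have ss : sorted <%O s.
  by rewrite lt_sorted_uniq_le us; exact: (sort_sorted leq_total).
have sz : size s = l by rewrite size_sort size_map size_tuple.
have cs k : count (fun v => removal_time f h v < k)%N u = count (fun x : nat => x < k)%N s.
  by rewrite (permP (permEl (perm_sort _ _))) count_map.
have hs k : has (fun v => k <= removal_time f h v)%N u = has (fun x : nat => k <= x)%N s.
  by rewrite (perm_has _ (permEl (perm_sort _ _))) has_map.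
have spE k : (k <= size h)%N -> spread (edges f) u (mkseq c k)
   = (count (fun x : nat => x < k)%N s + has (fun x : nat => k <= x)%N s)%N.
  by move=> kh; rewrite cE // spread_take // cs hs.
have cm : count (fun x : nat => x < m)%N s = i.
  by apply: (count_lt_nth _ ss); rewrite sz ltnW.
have cm1 : count (fun x : nat => x < m.+1)%N s = i.+1.
  by apply: (count_le_nth _ ss); rewrite sz ltnW.
have ilt : (i.+1 < size s)%N by rewrite sz.
have hm1 : has (fun x : nat => m < x)%N s.
  apply/hasP; exists (nth 0%N s i.+1); first exact: mem_nth.
  rewrite /m; have := @lt_sorted_ltn_nth _ _ 0%N s ss i i.+1.
  by rewrite !inE ilt (ltnW ilt) => /(_ isT isT); rewrite ltnSn.
rewrite /disconnection_time; set p := fun k => _.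
have mn : (m.+1 < size (iota 0 n.+1))%N by rewrite size_iota ltnS (leq_trans mh).
have pm : p m.+1 by rewrite /p spE // cm1 hm1 addn1.
(* At most [i] distinguished vertices are detached by then, and the root component accounts for at
   most one more component. *)
have pN k : (k <= m)%N -> ~~ p k.
  move=> km; rewrite /p spE ?(leq_trans km (ltnW mh)) //.
  have : (count (fun x : nat => (x < k)%N) s <= i)%N.
    by rewrite -cm; apply: sub_count => x /= /leq_trans; apply.
  by case: has; rewrite neq_ltn ltnS; lia.
have nth_io k : (k < size (iota 0 n.+1))%N -> nth 0%N (iota 0 n.+1) k = k.
  by rewrite size_iota => kn; rewrite nth_iota.
apply/eqP; rewrite eqn_leq; apply/andP; split.
  rewrite leqNgt; apply/negP => /(before_find 0%N).
  by rewrite nth_io // pm.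
rewrite ltnNge; apply/negP => fm.
have fs : (find p (iota 0 n.+1) < size (iota 0 n.+1))%N.
  by apply: leq_ltn_trans mn; apply: leq_trans fm _.
have : p (nth 0%N (iota 0 n.+1) (find p (iota 0 n.+1))).
  by apply: nth_find; rewrite has_find.
by rewrite nth_io // (negbTE (pN _ fm)).
Qed.

(** The hypothesis on removal times says that a detached component holds at most one distinguished
    vertex, hence is discarded; the last one says that the root component is still kept. *)
Lemma kept_edgesE f h (l : nat) (u : l.-tuple V) : parent_fun f ->
  root_cuts f h ->
  (forall v w, v \in u -> w \in u -> removal_time f h v = removal_time f h w ->
    (removal_time f h v < size h)%N -> v = w) ->
  (exists v w, [/\ v \in u, w \in u, v != w, v \in alive f h & w \in alive f h]) ->
  kept_edges (edges f) u (map (edge f) h)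
  = [set edge f v | v in alive f h :\ ord0]%SET.
Proof.
move=> pf rh hu [a [b [au bu ab aA bA]]].
have cardP x : (1 < #|[set v in u | v \in component (remaining (edges f)
    (map (edge f) h)) x]%SET|)%N = (x \in alive f h).
  rewrite component_remaining // aliveE; apply/idP/eqP => [|xh].
    case/card_gt1P => v [w] [vS wS vw]; move: vS wS; rewrite !inE.
    move=> /andP[vu /eqP vx] /andP[wu /eqP wx]; apply/eqP.
    rewrite -vx eqn_leq removal_time_le leqNgt; apply: contra vw => vh.
    by apply/eqP/hu; rewrite ?vx ?wx // -vx.
  move: aA bA; rewrite !aliveE => /eqP ah /eqP bh.
  by apply/card_gt1P; exists a, b; split=> //; rewrite !inE ?au ?bu ?ah ?bh xh eqxx.
have nh v : v != ord0 -> v \in alive f h -> v \notin h.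
  by move=> v0; rewrite inE => /hasPn A; apply/negP => /A; rewrite cut_refl.
have aliveP v : v \notin h -> (f v \in alive f h) = (v \in alive f h).
  by move=> vh; rewrite -!(top_eq0 rh) top_parent.
apply/setP => e; rewrite inE; apply/andP/imsetP => [[]|[v]].
  move=> /(mem_remaining pf rh)[v /andP[v0 vh] ->] /existsP[x /andP[xe]].
  rewrite cardP => xA; exists v => //; rewrite in_setD1 v0 /=.
  by move: xe xA => /set2P[]-> //; rewrite aliveP.
rewrite in_setD1 => /andP[v0 vA] ->; split.
  by apply/(mem_remaining pf rh); exists v; rewrite // v0 nh.
by apply/existsP; exists v; rewrite cardP vA set21.
Qed.

Lemma card_alive_edges f h : parent_fun f ->
  #|[set edge f v | v in alive f h :\ ord0]%SET| = #|alive f h|.-1.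
Proof.
move=> pf; rewrite card_in_imset.
  by rewrite (cardsD1 ord0 (alive f h)) ord0_alive.
by move=> v w; rewrite !in_setD1 => /andP[v0 _] /andP[w0 _]; exact: edge_inj.
Qed.

End RootComponent.

(** * Resampling one parent *)

Section Resampling.
Variables (R : realFieldType) (n : nat).
Local Notation V := 'I_n.+1.
Implicit Types (f g : {ffun V -> V}) (i a v w x y : V) (s : seq V) (A : {set V}).

Definition upd f i a : {ffun V -> V} := [ffun j => if j == i then a else f j].

Lemma upd_id f i a : upd (upd f i a) i (f i) = f.
Proof. by apply/ffunP => j; rewrite !ffunE; case: eqP => // ->. Qed.

Lemma updE f i a : upd f i a i = a.
Proof. by rewrite ffunE eqxx. Qed.

Lemma upd_neq f i a j : j != i -> upd f i a j = f j.
Proof. by rewrite ffunE => /negbTE ->. Qed.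

Lemma parent_fun_upd f i a : parent_fun f -> (a < i)%N -> parent_fun (upd f i a).
Proof.
move=> /forallP pf ai; apply/forallP => j; rewrite ffunE.
case: (eqVneq j i) => [->|_]; last exact: pf.
by case: eqP ai => [->|].
Qed.

(** Neither the moved vertex nor its new parent is below [v], so [v] neither gains nor loses
    descendants. *)
Lemma cut_upd f i a v : parent_fun f -> (a < i)%N ->
  i \notin cut f v -> a \notin cut f v -> cut (upd f i a) v = cut f v.
Proof.
move=> pf ai iv av; apply/setP => w; have [m] := ubnP w; elim: m w => // m IH w wm.
rewrite cutE [RHS]cutE; have [v0|//] := boolP (v != ord0); rewrite /=.
have [wv|wv] := eqVneq w v; first by [].
have [wi|wi] := eqVneq w i.
  rewrite wi updE IH ?(negbTE av); last first.
    by move: ai wm; rewrite -wi => ai wm; apply: leq_trans ai _.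
  by apply/esym/negbTE; apply: contra iv; rewrite [i \in _]cutE v0 => /= ->; rewrite orbT.
rewrite upd_neq //; have [w0|w0] := eqVneq w ord0.
  rewrite w0 parent_fun0 // (negbTE (notin_cut0 _ pf)).
  exact/negbTE/notin_cut0/parent_fun_upd.
by apply: IH; apply: leq_trans (parent_fun_lt pf w0) _.
Qed.

Lemma cut_upd_lt f i a v w : parent_fun f -> (a < i)%N -> (w < i)%N ->
  (w \in cut (upd f i a) v) = (w \in cut f v).
Proof.
move=> pf ai; have [m] := ubnP w; elim: m w => // m IH w wm wi.
have [w0|w0] := eqVneq w ord0.
  rewrite w0 (negbTE (notin_cut0 _ pf)).
  exact/negbTE/notin_cut0/parent_fun_upd.
have fw := parent_fun_lt pf w0.
rewrite cutE [RHS]cutE upd_neq; last by apply: contraTneq wi => ->; rewrite ltnn.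
by rewrite IH ?(ltn_trans fw wi) // (leq_trans fw).
Qed.

(** The removed sets do not reveal which alive vertex is the parent of [i]: this is why the root
    component remains a random recursive tree. *)
Lemma alive_upd f i a s : parent_fun f -> (a < i)%N ->
  i \in alive f s -> a \in alive f s -> alive (upd f i a) s = alive f s.
Proof.
move=> pf ai; elim: s => [|v s IH]; first by rewrite !alive_nil.
rewrite !alive_cons => /setDP[iA iv] /setDP[aA av].
by rewrite IH // cut_upd.
Qed.

Definition parents_below A i : {set V} := [set a in A | (a < i)%N]%SET.

Section WeightedSums.
(** [W] stands for the unnormalised law of the tree on the event that a given history leaves the
    vertices of [A]. No sign is assumed, as the weight is later multiplied by a function of the
    history. *)
Variables (A : {set V}) (W : {ffun V -> V} -> R).
Hypothesis W0 : forall f, W f != 0 ->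
  parent_fun f /\ forall i, i \in A -> f i \in A.
Hypothesis W1 : forall f i a, parent_fun f -> i \in A -> a \in A ->
  (a < i)%N -> f i \in A -> W (upd f i a) = W f.
Hypothesis A0 : ord0 \in A.

(* [(f, a) |-> (upd f i a, f i)] is an involution preserving the weight. *)
Lemma resample i (phi : {ffun V -> V} -> R) : i \in A -> i != ord0 ->
  \sum_f W f * (\sum_(a in parents_below A i) phi (upd f i a))
  = #|parents_below A i|%:R * \sum_f W f * phi f.
Proof.
move=> iA i0.
pose P (p : {ffun V -> V} * V) :=
  [&& parent_fun p.1, p.1 i \in A & p.2 \in parents_below A i].
have WP f : W f != 0 -> parent_fun f && (f i \in A).
  by case/W0 => -> /(_ i iA) ->.
have E (psi : {ffun V -> V} -> V -> R) :
    \sum_f W f * (\sum_(a in parents_below A i) psi f a)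
    = \sum_(p | P p) W p.1 * psi p.1 p.2.
  rewrite (eq_bigl (fun p : {ffun V -> V} * V =>
      (parent_fun p.1 && (p.1 i \in A)) && (p.2 \in parents_below A i))); last first.
    by move=> p; rewrite /P andbA.
  rewrite -(pair_big_dep (fun f => parent_fun f && (f i \in A))
    (fun _ a => a \in parents_below A i) (fun f a => W f * psi f a)) /=.
  rewrite [LHS](bigID (fun f => parent_fun f && (f i \in A))) /=.
  rewrite [X in _ + X = _]big1 ?addr0; last first.
    move=> f; apply: contraNeq => h; apply: WP; apply: contraNneq h => ->.
    by rewrite mul0r.
  by apply: eq_bigr => f _; rewrite mulr_sumr.
have -> : #|parents_below A i|%:R * \sum_f W f * phi f
    = \sum_f W f * (\sum_(a in parents_below A i) phi f).
  rewrite mulr_sumr; apply: eq_bigr => f _.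
  by rewrite sumr_const mulr_natl mulrnAr.
rewrite (E (fun f a => phi (upd f i a))) (E (fun f _ => phi f)).
pose h (p : {ffun V -> V} * V) := (upd p.1 i p.2, p.1 i).
have hK p : h (h p) = p by case: p => f a; rewrite /h /= updE upd_id.
rewrite [RHS](reindex_onto h h) /=; last by move=> p _; exact: hK.
apply: eq_big => [[f a]|[f a]].
  rewrite hK eqxx andbT /P /= updE !inE.
  apply/and3P/and3P => -[pf fA] /andP[aA ai].
    by rewrite fA parent_fun_lt // parent_fun_upd.
  have pf' : parent_fun f.
    apply/forallP => j; have := forallP pf j; rewrite ffunE.
    case: (eqVneq j i) => [->|//]; rewrite (negbTE i0) => _; exact: ai.
  have := forallP pf i; rewrite (negbTE i0) updE => ->.
  by rewrite fA aA.
move=> /and3P[/= pf fA]; rewrite inE => /andP[aA ai].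
by rewrite (W1 pf iA aA ai fA).
Qed.

Definition below f v (i : nat) : nat :=
  #|[set w in A | (w < i)%N && (w \in cut f v)]%SET|.

(** The vertex [i] joins the subtree of [v] when [v] is [i] or when its new parent belongs to it.
    The two cases exclude each other, as descendants of [i] have labels at least [i]. *)
Lemma below_upd f i a v : parent_fun f -> i \in A -> a \in A -> (a < i)%N ->
  below (upd f i a) v i.+1 = (below f v i + (v == i) + (a \in cut f v))%N.
Proof.
move=> pf iA aA ai.
have i0 : i != ord0 by apply: contraTneq ai => ->.
have iN : i \notin [set w in A | (w < i)%N && (w \in cut f v)]%SET.
  by rewrite !inE ltnn andbF.
transitivity #|[set w in A | (w < i)%N && (w \in cut f v)]
   :|: (if (i == v) || (a \in cut f v) then [set i] else finset.set0)|%SET.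
  have memE g (j : nat) w : (w \in [set w in A | (w < j)%N && (w \in cut g v)]%SET)
    = [&& w \in A, (w < j)%N & w \in cut g v] by rewrite inE.
  apply: eq_card => w; rewrite finset.in_setU !memE ltnS.
  have [wi|wi|/val_inj ->] := ltngtP w i.
  - by rewrite cut_upd_lt //; case: ifP; rewrite !inE ?orbF //;
      have [wi'|] := eqVneq w i; rewrite ?orbF //; move: wi; rewrite wi' ltnn.
  - rewrite !andbF; case: ifP; rewrite !inE ?orbF //.
    by have [wi'|] := eqVneq w i; rewrite ?orbF //; move: wi; rewrite wi' ltnn.
  - rewrite iA /= cutE updE cut_upd_lt //.
    have [->|v0] /= := eqVneq v ord0.
      by rewrite (negbTE i0) cut0 inE /= inE.
    by case: ifP => _; [rewrite finset.in_set1 eqxx|rewrite finset.in_set0].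
have vaF : v = i -> a \in cut f v -> False.
  by move=> -> /(cut_le pf); rewrite leqNgt ai.
rewrite eq_sym -addnA; case: (eqVneq v i) vaF => [vi|vi] /= vaF.
  case: (boolP (a \in cut f v)) => [/(vaF vi)//|_].
  by rewrite finset.setUC cardsU1 iN -/(below f v i) /= ?addn0 ?add0n addnC.
case: (boolP (a \in cut f v)) => _; last by rewrite finset.setU0 !addn0.
by rewrite finset.setUC cardsU1 iN -/(below f v i) /= ?addn0 ?add0n addnC.
Qed.

Lemma below_skip f v (i : V) : i \notin A -> below f v i.+1 = below f v i.
Proof.
move=> iA; apply: eq_card => w; rewrite !inE ltnS leq_eqVlt.
have [wA|//] := boolP (w \in A); rewrite /=.
by have [/val_inj wi|//] := eqVneq (w : nat) i; rewrite wi (negbTE iA) in wA.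
Qed.

Lemma below_self f v : parent_fun f -> below f v v = 0%N.
Proof.
move=> pf; apply/eqP; rewrite cards_eq0; apply/eqP/setP => w; rewrite !inE.
apply/negP => /and3P[_ wv wc]; move: (cut_le pf (w := w) (v := v)).
by rewrite inE wc => /(_ isT); rewrite leqNgt wv.
Qed.

Lemma sum_below f v i : \sum_(a in parents_below A i) (a \in cut f v)%:R
  = (below f v i)%:R :> R.
Proof.
rewrite -natr_sum; congr _%:R; rewrite /below -sum1_card big_mkcond [RHS]big_mkcond /=.
by apply: eq_bigr => w _; rewrite !inE; case: (w \in A); case: (w < i)%N => //=;
  case: (_ && _).
Qed.

(** Up to normalisation, the first two moments of the size of the subtree cut off at a uniform
    vertex. The root contributes 0, its [cut] being empty. *)
Definition moment1 f (i : nat) : R := \sum_(v in A) (below f v i)%:R.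
Definition moment2 f (i : nat) : R := \sum_(v in A) (below f v i)%:R ^+ 2.

Lemma sum_eq1 i : i \in A -> \sum_(v in A) (v == i)%:R = 1 :> R.
Proof.
by move=> iA; rewrite (bigD1 i) //= eqxx big1 ?addr0 // => v /andP[_ /negbTE ->].
Qed.

Lemma sum_moment1_upd f i : parent_fun f -> i \in A ->
  \sum_(a in parents_below A i) moment1 (upd f i a) i.+1
  = #|parents_below A i|%:R * (moment1 f i + 1) + moment1 f i.
Proof.
move=> pf iA; transitivity (\sum_(a in parents_below A i)
   (moment1 f i + 1 + \sum_(v in A) (a \in cut f v)%:R)).
  apply: eq_bigr => a; rewrite inE => /andP[aA ai].
  rewrite -[X in _ + X + _](sum_eq1 iA) -!big_split /=; apply: eq_bigr => v vA.
  by rewrite below_upd // !natrD.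
rewrite big_split /= sumr_const mulr_natl; congr (_ + _).
by rewrite exchange_big /=; apply: eq_bigr => v _; rewrite sum_below.
Qed.

Lemma sum_moment2_upd f i : parent_fun f -> i \in A ->
  \sum_(a in parents_below A i) moment2 (upd f i a) i.+1
  = #|parents_below A i|%:R * (moment2 f i + 1) + moment2 f i *+ 2 + moment1 f i.
Proof.
(* An indicator x satisfies (s + x)^2 = s^2 + (2 s + 1) x; for [v = i] the subtree starts empty and
   gets size 1. *)
move=> pf iA; transitivity (\sum_(a in parents_below A i)
   (moment2 f i + 1
    + \sum_(v in A) (2 * (below f v i)%:R + 1) * (a \in cut f v)%:R)).
  apply: eq_bigr => a; rewrite inE => /andP[aA ai].
  rewrite -[X in _ + X + _](sum_eq1 iA) -!big_split /=; apply: eq_bigr => v vA.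
  rewrite below_upd // !natrD; have [vi|vi] := eqVneq v i.
    have -> : (a \in cut f v) = false.
      by apply/negP => /(cut_le pf); rewrite vi leqNgt ai.
    by rewrite vi below_self //=; ring.
  by case: (a \in cut f v); rewrite /=; ring.
rewrite big_split /= sumr_const mulr_natl -addrA; congr (_ + _).
rewrite exchange_big /= -[moment2 f i *+ 2]mulr_natl /moment2 /moment1 mulr_sumr -big_split /=.
by apply: eq_bigr => v _; rewrite -mulr_sumr sum_below; ring.
Qed.

Definition harmonic_sum (m : nat) : R := \sum_(k < m) k.+1%:R^-1.

Lemma harmonic_sumS m : harmonic_sum m.+1 = harmonic_sum m + m.+1%:R^-1.
Proof. by rewrite /harmonic_sum big_ord_recr. Qed.

(* The vertices of [A] are added one at a time: the new vertex [i] belongs to the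
   subtrees of its ancestors, and its parent is uniform among the [m] previous ones.
   The closed forms solve the resulting recursions. *)
Lemma weighted_moments (i : nat) : (0 < i <= n.+1)%N ->
  let m := #|[set a in A | (a < i)%N]%SET| in
  \sum_f W f * moment1 f i = (m%:R * harmonic_sum m - m%:R) * \sum_f W f /\
  \sum_f W f * moment2 f i = (m%:R ^+ 2 - m%:R * harmonic_sum m) * \sum_f W f.
Proof.
have Weq (F G : {ffun V -> V} -> R) : (forall f, parent_fun f -> F f = G f) ->
    \sum_f W f * F f = \sum_f W f * G f.
  move=> FG; apply: eq_bigr => f _; have [->|/W0[pf _]] := eqVneq (W f) 0.
    by rewrite !mul0r.
  by rewrite FG.
elim: i => // -[_ _|i IH /andP[_ iN]] /=.
  have -> : [set a in A | (a < 1)%N]%SET = [set ord0]%SET.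
    apply/setP => a; rewrite !inE ltnS leqn0; apply/andP/eqP => [[_ /eqP a0]|->].
      exact: val_inj.
    by rewrite A0.
  have E f v : parent_fun f -> below f v 1 = 0%N.
    move=> pf; apply/eqP; rewrite cards_eq0; apply/eqP/setP => w; rewrite !inE.
    apply/negP => /and3P[_]; rewrite ltnS leqn0 => /eqP w0.
    have -> : w = ord0 by exact: val_inj.
    by move=> h; have := notin_cut0 v pf; rewrite inE h.
  rewrite cards1 harmonic_sumS /harmonic_sum big_ord0 invr1 add0r mul1r subrr mul0r.
  rewrite expr1n subrr mul0r; split; apply: big1 => f _;
    have [->|/W0[pf _]] := eqVneq (W f) 0; rewrite ?mul0r //;
    by rewrite [X in _ * X]big1 ?mulr0 // => v _; rewrite E // expr0n.
have [{}IH1 {}IH2] := IH (ltnW iN).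
pose j : V := Ordinal iN; have jE : i.+1 = j by [].
rewrite jE in IH1 IH2 *; set M := #|_| in IH1 IH2.
have [jA|jA] := boolP (j \in A); last first.
  have -> : #|[set a in A | (a < j.+1)%N]%SET| = M.
    apply: eq_card => a; rewrite !inE ltnS leq_eqVlt.
    have [aA|//] := boolP (a \in A); rewrite /=.
    by have [/val_inj aj|//] := eqVneq (a : nat) j; rewrite aj (negbTE jA) in aA.
  rewrite -IH1 -IH2; split; apply: eq_bigr => f _; congr (_ * _);
  by apply: eq_bigr => v _; rewrite below_skip.
have j0 : j != ord0 by [].
have M0 : (0 < M)%N by apply/card_gt0P; exists ord0; rewrite inE A0.
have -> : #|[set a in A | (a < j.+1)%N]%SET| = M.+1.
  rewrite (_ : [set a in A | (a < j.+1)%N]%SET = j |: [set a in A | (a < j)%N])%SET.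
    by rewrite cardsU1 inE ltnn andbF.
  apply/setP => a; rewrite !inE ltnS leq_eqVlt.
  have [->|aj] := eqVneq a j; first by rewrite jA eqxx.
  by rewrite -[(a == j :> nat)]/(a == j) (negbTE aj).
have MN0 : M%:R != 0 :> R by rewrite pnatr_eq0 -lt0n.
have MS0 : M.+1%:R != 0 :> R by rewrite pnatr_eq0.
have S0 : \sum_f W f * 1 = \sum_f W f by under eq_bigr do rewrite mulr1.
(* Multiplying by the number [M] of possible parents of [j] allows [resample] to be used from right
   to left, which expresses the sums at [j.+1] through those at [j]. *)
split; apply: (mulfI MN0).
  rewrite -(resample (fun f => moment1 f j.+1) jA j0).
  rewrite (Weq _ (fun f => M%:R * (moment1 f j + 1) + moment1 f j)); last first.
    by move=> f pf; rewrite sum_moment1_upd.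
  transitivity ((M%:R + 1) * (\sum_f W f * moment1 f j) + M%:R * \sum_f W f * 1).
    rewrite !mulr_sumr -big_split /=; apply: eq_bigr => f _; ring.
  rewrite S0 IH1 harmonic_sumS -natr1; move: MS0; rewrite -natr1 => MS0; field.
  exact: MS0.
rewrite -(resample (fun f => moment2 f j.+1) jA j0).
rewrite (Weq _ (fun f => M%:R * (moment2 f j + 1) + moment2 f j *+ 2 + moment1 f j)); last first.
  by move=> f pf; rewrite sum_moment2_upd.
transitivity ((M%:R + 2) * (\sum_f W f * moment2 f j) + M%:R * (\sum_f W f * 1)
   + \sum_f W f * moment1 f j).
  rewrite !mulr_sumr -!big_split /=; apply: eq_bigr => f _; ring.
rewrite S0 IH1 IH2 harmonic_sumS -natr1; move: MS0; rewrite -natr1 => MS0; field.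
exact: MS0.
Qed.

End WeightedSums.
End Resampling.

(** * The root chain *)

Section RootChain.
Variables (R : realFieldType) (n : nat).
Local Notation V := 'I_n.+1.
Local Notation H := (harmonic_sum R).
Implicit Types (f : {ffun V -> V}) (i a v w : V) (s : seq V) (A : {set V}).
Implicit Types (g : {ffun V -> V} -> seq V -> R).

(* The dummy cut at [ord0] lets the chain idle once the root is isolated. *)
Definition candidates A : {set V} :=
  if A == [set ord0]%SET then A else (A :\ ord0)%SET.

(* Histories are listed with the most recent cut first. *)
Fixpoint chain_weight f s : R :=
  if s is v :: s' then
    chain_weight f s' * (v \in candidates (alive f s'))%:R
      / #|candidates (alive f s')|%:R
  else 1.

(** The expectation of [g] for a uniform tree and [k] cuts of the chain, as a finite sum. *)
Definition chain_mean k g : R := (#|[set f | @parent_fun n f]%SET|%:R)^-1 *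
  \sum_(f | parent_fun f) \sum_(s : k.-tuple V) chain_weight f s * g f s.

Lemma chain_weight_ge0 f s : 0 <= chain_weight f s.
Proof. by elim: s => //= v s IH; rewrite !mulr_ge0 ?invr_ge0. Qed.

Lemma card_candidates A : ord0 \in A -> #|candidates A| = maxn 1 #|A|.-1.
Proof.
move=> A0; rewrite /candidates; case: eqP => [->|AN]; first by rewrite cards1.
have := cardsD1 ord0 A; rewrite A0 add1n => cA; rewrite cA /=.
rewrite (maxn_idPr _) // lt0n; apply/eqP => /eqP; rewrite cards_eq0 => /eqP A1.
by apply: AN; rewrite -(finset.setD1K A0) A1 finset.setU0.
Qed.

Lemma card_candidates_gt0 A : ord0 \in A -> (0 < #|candidates A|)%N.
Proof. by move=> /card_candidates ->; rewrite leq_max. Qed.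

Lemma sum_tuple_cons k (F : seq V -> R) :
  \sum_(s : k.+1.-tuple V) F s = \sum_(s : k.-tuple V) \sum_v F (v :: s).
Proof.
rewrite (reindex (fun p : V * k.-tuple V => [tuple of p.1 :: p.2])) /=; last first.
  exists (fun s : k.+1.-tuple V => (thead s, [tuple of behead s])) => [[v s] _|s _] /=.
    by congr pair; apply/val_inj.
  by rewrite -tuple_eta.
rewrite -(pair_bigA _ (fun v (s : k.-tuple V) => F (v :: s))) /=.
by rewrite exchange_big.
Qed.

Lemma chain_meanS k g : chain_mean k.+1 g = chain_mean k (fun f s =>
  #|candidates (alive f s)|%:R^-1 * \sum_(v in candidates (alive f s)) g f (v :: s)).
Proof.
congr (_ * _); apply: eq_bigr => f pf.
rewrite (sum_tuple_cons k (fun s => chain_weight f s * g f s)); apply: eq_bigr => s _ /=.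
rewrite mulrA mulr_sumr [RHS]big_mkcond /=; apply: eq_bigr => v _.
by case: ifP => _; rewrite /= ?mulr1 // mulr0 !mul0r.
Qed.

Lemma chain_mean0 g : chain_mean 0 g = (#|[set f | @parent_fun n f]%SET|%:R)^-1 *
  \sum_(f | parent_fun f) g f [::].
Proof.
congr (_ * _); apply: eq_bigr => f _; rewrite (big_pred1 [tuple]) /= ?mul1r //.
by move=> s; rewrite (tuple0 s) /= eqxx.
Qed.

Lemma chain_mean_eq k g g' :
  (forall f s, parent_fun f -> size s = k -> chain_weight f s != 0 -> g f s = g' f s) ->
  chain_mean k g = chain_mean k g'.
Proof.
move=> gg; congr (_ * _); apply: eq_bigr => f pf; apply: eq_bigr => s _.
have [->|w0] := eqVneq (chain_weight f s) 0; first by rewrite !mul0r.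
by rewrite gg ?size_tuple.
Qed.

Lemma chain_mean_le k g g' :
  (forall f s, parent_fun f -> size s = k -> chain_weight f s != 0 -> g f s <= g' f s) ->
  chain_mean k g <= chain_mean k g'.
Proof.
move=> gg; rewrite ler_wpM2l ?invr_ge0 //; apply: ler_sum => f pf.
apply: ler_sum => s _.
have [->|w0] := eqVneq (chain_weight f s) 0; first by rewrite !mul0r.
by rewrite ler_wpM2l ?chain_weight_ge0 // gg ?size_tuple.
Qed.

Lemma chain_meanD k g g' :
  chain_mean k (fun f s => g f s + g' f s) = chain_mean k g + chain_mean k g'.
Proof.
rewrite -mulrDr -big_split /=; congr (_ * _); apply: eq_bigr => f _.
by rewrite -big_split /=; apply: eq_bigr => s _; rewrite mulrDr.
Qed.

Lemma chain_meanZ k c g :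
  chain_mean k (fun f s => c * g f s) = c * chain_mean k g.
Proof.
rewrite mulrCA; congr (_ * _); rewrite mulr_sumr; apply: eq_bigr => f _.
by rewrite mulr_sumr; apply: eq_bigr => s _; rewrite mulrCA.
Qed.

Lemma chain_mean_sum k (I : finType) (P : pred I) (G : I -> {ffun V -> V} -> seq V -> R) :
  chain_mean k (fun f s => \sum_(i | P i) G i f s) = \sum_(i | P i) chain_mean k (G i).
Proof.
rewrite /chain_mean -mulr_sumr; congr (_ * _).
rewrite [RHS]exchange_big /=; apply: eq_bigr => f _; rewrite [RHS]exchange_big /=.
by apply: eq_bigr => s _; rewrite mulr_sumr.
Qed.

Lemma card_parent_fun_neq0 : #|[set f | @parent_fun n f]%SET|%:R != 0 :> R.
Proof.
rewrite pnatr_eq0 -lt0n; apply/card_gt0P.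
by have [f pf] := parent_fun_ex n; exists f; rewrite inE.
Qed.

(** Dropping [j] entries forgets the latest cuts, whose transition probabilities sum to 1 since
    there is always a candidate. *)
Lemma chain_mean_drop j k g :
  chain_mean (j + k) (fun f s => g f (drop j s)) = chain_mean k g.
Proof.
elim: j => [|j IH]; first by apply: chain_mean_eq => f s _ _ _; rewrite drop0.
rewrite addSn chain_meanS -IH; apply: chain_mean_eq => f s pf _ _.
rewrite /= sumr_const -[X in _ * X]mulr_natl mulrA mulVf ?mul1r //.
by rewrite pnatr_eq0 -lt0n card_candidates_gt0 // ord0_alive.
Qed.

Lemma chain_mean_cst k (c : R) : chain_mean k (fun _ _ => c) = c.
Proof.
have := chain_mean_drop k 0 (fun _ _ => c); rewrite addn0 => ->.
rewrite chain_mean0 sumr_const -[X in _ * X]mulr_natl mulrA cardsE mulVf ?mul1r //.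
by have := card_parent_fun_neq0; rewrite cardsE.
Qed.

Lemma alive_parent f s i : parent_fun f -> i \in alive f s -> f i \in alive f s.
Proof.
move=> pf; rewrite !inE; apply: contra => /hasP[v vs fi]; apply/hasP; exists v => //.
by rewrite cutE fi orbT andbT; apply: contraTneq fi => ->; rewrite cut0 inE.
Qed.

Lemma alive_consP f v s w : w \in alive f (v :: s) -> w \in alive f s.
Proof. by rewrite alive_cons => /setDP[]. Qed.

Lemma chain_weight_upd f s i a : parent_fun f -> (a < i)%N ->
  i \in alive f s -> a \in alive f s -> chain_weight (upd f i a) s = chain_weight f s.
Proof.
move=> pf ai; elim: s => //= v s IH /alive_consP iA /alive_consP aA.
by rewrite IH // alive_upd.
Qed.

(** Such a [g] is insensitive to the resampling of parents in the root component, and thus acts as a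
    constant when conditioning on the history. *)
Definition history_function g : Prop := forall f s i a, parent_fun f ->
  (a < i)%N -> i \in alive f s -> a \in alive f s -> g (upd f i a) s = g f s.

Definition jump f s v : nat := #|(cut f v :&: alive f s)%SET|.

Lemma chain_mean_moments k g : history_function g ->
  chain_mean k (fun f s => g f s * \sum_(v in alive f s) (jump f s v)%:R)
    = chain_mean k (fun f s => g f s *
        (#|alive f s|%:R * H #|alive f s| - #|alive f s|%:R)) /\
  chain_mean k (fun f s => g f s * \sum_(v in alive f s) (jump f s v)%:R ^+ 2)
    = chain_mean k (fun f s => g f s *
        (#|alive f s|%:R ^+ 2 - #|alive f s|%:R * H #|alive f s|)).
Proof.
move=> gi; rewrite /chain_mean.
have split_sum (F : {ffun V -> V} -> seq V -> R) :
    \sum_(f | parent_fun f) \sum_(s : k.-tuple V) chain_weight f s * (g f s * F f s)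
  = \sum_(s : k.-tuple V) \sum_A \sum_f
      (if parent_fun f && (alive f s == A) then chain_weight f s * g f s else 0) * F f s.
  rewrite exchange_big /=; apply: eq_bigr => s _.
  rewrite exchange_big /= [LHS]big_mkcond /=; apply: eq_bigr => f _.
  case: ifP => pf /=; last by rewrite big1 // => A _; rewrite mul0r.
  rewrite (bigD1 (alive f s)) //= eqxx big1 ?addr0 ?mulrA // => A.
  by rewrite eq_sym => /negbTE ->; rewrite mul0r.
(* Once the history and the remaining set are fixed, the weight times [g] meets the hypotheses of
   [weighted_moments], applied at [n.+1] so as to include all labels. *)
suff key (s : seq V) A :
  let W f := if parent_fun f && (alive f s == A)
    then chain_weight f s * g f s else 0 in
  \sum_f W f * (\sum_(v in alive f s) (jump f s v)%:R) =
  \sum_f W f * (#|alive f s|%:R * H #|alive f s| - #|alive f s|%:R) /\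
  \sum_f W f * (\sum_(v in alive f s) (jump f s v)%:R ^+ 2) =
  \sum_f W f * (#|alive f s|%:R ^+ 2 - #|alive f s|%:R * H #|alive f s|).
  split; congr (_ * _).
    rewrite (split_sum (fun f s => \sum_(v in alive f s) (jump f s v)%:R)).
    rewrite (split_sum (fun f s => #|alive f s|%:R * H #|alive f s| - #|alive f s|%:R)).
    by apply: eq_bigr => s _; apply: eq_bigr => A _; have [] := key s A.
  rewrite (split_sum (fun f s => \sum_(v in alive f s) (jump f s v)%:R ^+ 2)).
  rewrite (split_sum (fun f s =>
    #|alive f s|%:R ^+ 2 - #|alive f s|%:R * H #|alive f s|)).
  by apply: eq_bigr => s _; apply: eq_bigr => A _; have [] := key s A.
move=> W; have WA (F G : {ffun V -> V} -> R) :
    (forall f, parent_fun f -> alive f s = A -> F f = G f) ->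
    \sum_f W f * F f = \sum_f W f * G f.
  move=> FG; apply: eq_bigr => f _; rewrite /W; case: ifP; rewrite ?mul0r //.
  by case/andP => pf /eqP fA; rewrite FG.
have [A0|A0] := boolP (ord0 \in A); last first.
  have WE f : W f = 0.
    rewrite /W; case: ifP => // /andP[pf /eqP fA].
    by rewrite -fA ord0_alive in A0.
  by split; rewrite !big1 // => f _; rewrite WE mul0r.
have W0 f : W f != 0 -> parent_fun f /\ forall i, i \in A -> f i \in A.
  rewrite /W; case: ifP; rewrite ?eqxx // => /andP[pf /eqP <-] _; split=> // i.
  exact: alive_parent.
have W1 f i a : parent_fun f -> i \in A -> a \in A ->
    (a < i)%N -> f i \in A -> W (upd f i a) = W f.
  move=> pf iA aA ai fiA; rewrite /W pf parent_fun_upd //=.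
  have i0 : i != ord0 by apply: contraTneq ai => ->.
  case: (eqVneq (alive f s) A) => [fA|fA].
    rewrite alive_upd ?fA // eqxx chain_weight_upd ?fA //.
    by rewrite gi ?fA.
  (* The converse follows by undoing the change of parent. *)
  case: eqP => // ufA; case/eqP: fA; rewrite -ufA.
  rewrite -{1}(upd_id f i a) alive_upd ?ufA ?parent_fun_upd //.
  exact: parent_fun_lt.
have [m1 m2] := weighted_moments W0 W1 A0 (i := n.+1) (ltnSn _).
have cardA : #|[set a in A | (a < n.+1)%N]%SET| = #|A|.
  by apply: eq_card => a; rewrite !inE ltn_ord andbT.
have jE f v : alive f s = A -> jump f s v = below A f v n.+1.
  move=> fA; rewrite /jump /below fA; apply: eq_card => w; rewrite finset.in_setI.
  by rewrite [RHS]inE ltn_ord andbC.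
rewrite cardA in m1 m2.
split.
- rewrite (WA _ (fun f => moment1 R A f n.+1)).
    by rewrite m1 mulrC mulr_suml; apply: WA => f _ ->.
  by move=> f _ fA; rewrite fA; apply: eq_bigr => v _; rewrite jE.
- rewrite (WA _ (fun f => moment2 R A f n.+1)).
    by rewrite m2 mulrC mulr_suml; apply: WA => f _ ->.
  by move=> f _ fA; rewrite fA; apply: eq_bigr => v _; rewrite jE.
Qed.

(** The conditional mean of the next jump when [m] vertices remain: the first moment divided by the
    number of candidates. The maximum with 1 covers the idle chain. *)
Definition drift (m : nat) : R := (m%:R * H m - m%:R) / (maxn 1 m.-1)%:R.

Fixpoint compensator f s : R :=
  if s is v :: s' then compensator f s' + drift #|alive f s'| else 0.

Definition martingale f s : R := #|alive f s|%:R + compensator f s - n.+1%:R.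

Lemma compensator_history : history_function compensator.
Proof.
move=> f s i a pf ai; elim: s => //= v s IH /alive_consP iA /alive_consP aA.
by rewrite IH // alive_upd.
Qed.

(** The candidates and the remaining vertices differ by the root at most, whose jump is 0; the
    positive exponent turns it into a zero term. *)
Lemma sum_candidates f s (p : nat) : parent_fun f ->
  \sum_(v in candidates (alive f s)) (jump f s v)%:R ^+ p.+1
  = \sum_(v in alive f s) (jump f s v)%:R ^+ p.+1 :> R.
Proof.
move=> pf; rewrite /candidates; case: ifP => // _.
rewrite [RHS](bigD1 ord0) ?ord0_alive //= /jump cut0 finset.set0I cards0.
rewrite expr0n /= add0r; apply: eq_bigl => v.
by rewrite in_setD1 andbC.
Qed.

Lemma martingale_cons f s v :
  martingale f (v :: s)
  = martingale f s + drift #|alive f s| - (jump f s v)%:R.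
Proof.
rewrite /martingale /= alive_cons cardsD finset.setIC -/(jump f s v).
rewrite natrB; first by ring.
by rewrite subset_leq_card // finset.subsetIr.
Qed.

Lemma harmonic_sum_ge1 m : (0 < m)%N -> 1 <= H m.
Proof.
case: m => // m _; elim: m => [|m IH].
  by rewrite harmonic_sumS /harmonic_sum big_ord0 add0r invr1.
by rewrite harmonic_sumS (le_trans IH) // lerDl invr_ge0.
Qed.

(** The increments are centred given the history, so their second moments add up; each is at most
    the conditional second moment of a jump, itself at most the number of remaining vertices. *)
Lemma martingale_moment2 k :
  chain_mean k (fun f s => martingale f s ^+ 2) <= (k * n.+1)%:R.
Proof.
elim: k => [|k IH].
  rewrite mul0n chain_mean0 big1 ?mulr0 // => f _.
  by rewrite /martingale /= alive_nil cardsT card_ord addr0 subrr expr0n.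
pose m f s := #|alive f s|.
pose c f s : R := (maxn 1 (m f s).-1)%:R.
pose d f s : R := drift (m f s).
have m0 f s : parent_fun f -> (0 < m f s)%N.
  by move=> pf; apply/card_gt0P; exists ord0; exact: ord0_alive.
have c0 f s : c f s != 0 by rewrite pnatr_eq0 -lt0n leq_max.
have mE f s i a : parent_fun f -> (a < i)%N -> i \in alive f s -> a \in alive f s ->
    m (upd f i a) s = m f s.
  by move=> pf ai iA aA; rewrite /m alive_upd.
have MH : history_function martingale.
  move=> f s i a pf ai iA aA; rewrite /martingale.
  by rewrite (compensator_history pf ai) // -!/(m _ _) mE.
have cH : history_function (fun f s => (c f s)^-1).
  by move=> f s i a pf ai iA aA; rewrite /c mE.
have gH : history_function (fun f s => -2 * (martingale f s + d f s) / c f s).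
  by move=> f s i a pf ai iA aA; rewrite /c /d mE // MH.
rewrite chain_meanS.
have -> : chain_mean k (fun f s => #|candidates (alive f s)|%:R^-1 *
      \sum_(v in candidates (alive f s)) martingale f (v :: s) ^+ 2)
  = chain_mean k (fun f s => (martingale f s + d f s) ^+ 2
    + (-2 * (martingale f s + d f s) / c f s * (\sum_(v in alive f s) (jump f s v)%:R)
    + (c f s)^-1 * (\sum_(v in alive f s) (jump f s v)%:R ^+ 2))).
  apply: chain_mean_eq => f s pf _ _.
  have cE : #|candidates (alive f s)|%:R = c f s.
    by rewrite card_candidates ?ord0_alive.
  have <- := sum_candidates s 1 pf.
  have <- : \sum_(v in candidates (alive f s)) (jump f s v)%:R
      = \sum_(v in alive f s) (jump f s v)%:R :> R := sum_candidates s 0 pf.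
  have -> : \sum_(v in candidates (alive f s)) martingale f (v :: s) ^+ 2
    = \sum_(v in candidates (alive f s)) ((martingale f s + d f s) ^+ 2
      + (-2 * (martingale f s + d f s) * (jump f s v)%:R + (jump f s v)%:R ^+ 2)).
    by apply: eq_bigr => v _; rewrite martingale_cons /d /m; ring.
  rewrite !big_split /= sumr_const -mulr_sumr -[X in _ * (X + _)]mulr_natl cE.
  by field; exact: c0.
rewrite !chain_meanD (chain_mean_moments k gH).1 (chain_mean_moments k cH).2.
rewrite -!chain_meanD mulSnr natrD.
rewrite -(chain_mean_cst k n.+1%:R).
apply: le_trans (lerD IH (lexx _)); rewrite -chain_meanD.
apply: chain_mean_le => f s pf _ _.
have -> : -2 * (martingale f s + d f s) / c f s *
    (#|alive f s|%:R * H #|alive f s| - #|alive f s|%:R)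
  = -2 * (martingale f s + d f s) * d f s.
  by rewrite /d /drift -/(m f s) -/(c f s); field; exact: c0.
(* The mean jump being [d], the square and the cross term combine into
   [martingale ^+ 2 - d ^+ 2]. *)
suff h : (c f s)^-1 * (#|alive f s|%:R ^+ 2 - #|alive f s|%:R * H #|alive f s|)
    <= n.+1%:R.
  by have := sqr_ge0 (d f s); nra.
have mn : (m f s <= n.+1)%N by rewrite -[X in (_ <= X)%N]card_ord max_card.
rewrite -!/(m f s); apply: (@le_trans _ _ (m f s)%:R); last by rewrite ler_nat.
rewrite mulrC ler_pdivrMr; last by rewrite lt0r c0 ler0n.
rewrite expr2 -mulrBr ler_wpM2l //.
have := harmonic_sum_ge1 (m0 f s pf).
rewrite /c; have := m0 f s pf; case: (m f s) => // -[|x] _.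
  by rewrite (_ : maxn 1 1.-1 = 1%N) // => h; lra.
by rewrite (maxn_idPr _) // -[x.+2%:R]natr1 => h; rewrite /=; lra.
Qed.

Lemma chain_chebyshev k (e : R) : 0 < e ->
  chain_mean k (fun f s => (e <= `|martingale f s|)%R%:R) <= (k * n.+1)%:R / e ^+ 2.
Proof.
move=> e0; have e2 : 0 < e ^+ 2 by rewrite exprn_gt0.
rewrite ler_pdivlMr // mulrC -chain_meanZ.
apply: le_trans (martingale_moment2 k); apply: chain_mean_le => f s _ _ _.
case: (lerP e `|martingale f s|) => h; rewrite ?mulr1 ?mulr0 ?sqr_ge0 //.
by rewrite -[leRHS]real_normK ?num_real // lerXn2r // nnegrE ?ltW.
Qed.

End RootChain.

(** * Concentration of the root chain *)

Section Ranks.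
Variables (n : nat) (t : 'I_n.+1 -> nat).
Local Notation V := 'I_n.+1.
Implicit Types (v w : V).

(** Labels are below [n.+1], so comparing keys is comparing the pairs [(t v, v)]
    lexicographically. *)
Let key v : nat := (t v * n.+1 + v)%N.

(* The rank of [v] by [t], ties being broken by labels. *)
Definition rank v : nat := #|[set w | (t w * n.+1 + w < t v * n.+1 + v)%N]%SET|.

Lemma rank_lt v : (rank v < n.+1)%N.
Proof.
rewrite -[X in (_ < X)%N]card_ord -cardsT; apply: proper_card.
by apply/properP; split; [exact: finset.subsetT|exists v; rewrite ?inE ?ltnn].
Qed.

Definition rank_ord v : V := Ordinal (rank_lt v).

Lemma rank_ord_inj : injective rank_ord.
Proof.
have lt v w : (key v < key w)%N -> (rank v < rank w)%N.
  move=> vw; apply: proper_card; apply/properP; split; last first.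
    by exists v; rewrite !inE ?ltnn.
  by apply/fintype.subsetP => x; rewrite !inE => /ltn_trans; apply.
move=> v w /(congr1 val) /= e.
case: (ltngtP (key v) (key w)) => [/lt|/lt|]; rewrite ?e ?ltnn //.
rewrite /key => /(congr1 (modn^~ n.+1)).
by rewrite !modnMDl !modn_small ?ltn_ord // => /val_inj.
Qed.

(** The vertices removed before time [k] occupy exactly the first ranks: this is how counts of
    remaining vertices give information on ranks. *)
Lemma rank_lt_card v k :
  (rank v < #|[set w | (t w < k)%N]%SET|)%N = (t v < k)%N.
Proof.
have keyk w : (t w < k)%N = (key w < k * n.+1)%N.
  by rewrite /key -ltn_divLR // divnMDl // divn_small ?ltn_ord // addn0.
apply/idP/idP => [|vk].
  apply: contraLR; rewrite -!leqNgt => kv; apply: subset_leq_card.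
  apply/fintype.subsetP => w; rewrite !inE keyk => /leq_trans; apply.
  by move: kv; rewrite leqNgt keyk -leqNgt.
apply: proper_card; apply/properP; split; last by exists v; rewrite !inE ?ltnn.
by apply/fintype.subsetP => w; rewrite !inE !keyk in vk * => /ltn_trans; apply.
Qed.

End Ranks.

(** * The drift is ln m up to an error of at most 1 *)

Section DriftBounds.
Variable R : realType.
Local Notation H := (harmonic_sum R).

Lemma harmonic_sum_le m : (0 < m)%N -> H m <= 1 + ln m%:R.
Proof.
case: m => // m _; elim: m => [|m IH].
  by rewrite harmonic_sumS /harmonic_sum big_ord0 add0r invr1 ln1 addr0.
rewrite harmonic_sumS.
suff hh : ln (m.+1%:R : R) - ln m.+2%:R <= - m.+2%:R^-1.
  by move: IH hh; move: (H _) (ln _) (ln _) (_^-1) => h a b c; lra.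
have p1 : 0 < m.+1%:R :> R by [].
have p2 : 0 < m.+2%:R :> R by [].
rewrite -ln_div ?posrE //.
have -> : m.+1%:R / m.+2%:R = 1 + (- m.+2%:R^-1) :> R.
  rewrite -[m.+2%:R]natr1; move: p1; move: (m.+1%:R) => a a0.
  by field; apply: lt0r_neq0; lra.
apply: le_ln1Dx; rewrite ltrN2 invf_lt1 // ltr1n //.
Qed.

Lemma harmonic_sum_ge m : ln m.+1%:R <= H m.
Proof.
elim: m => [|m IH]; first by rewrite ln1 /harmonic_sum big_ord0.
rewrite harmonic_sumS.
suff hh : ln (m.+2%:R : R) - ln m.+1%:R <= m.+1%:R^-1.
  by move: IH hh; move: (H _) (ln _) (ln _) (_^-1) => h a b c; lra.
have p1 : 0 < m.+1%:R :> R by [].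
have p2 : 0 < m.+2%:R :> R by [].
rewrite -ln_div ?posrE //.
have -> : m.+2%:R / m.+1%:R = 1 + m.+1%:R^-1 :> R.
  rewrite -[m.+2%:R]natr1; move: p1; move: (m.+1%:R) => a a0.
  by field; apply: lt0r_neq0.
by apply: le_ln1Dx; apply: (lt_trans _ (_ : 0 < _)); rewrite ?invr_gt0 // ltrN10.
Qed.

Lemma ln_le_subr1 (x : R) : 0 < x -> ln x <= x - 1.
Proof.
by move=> x0; rewrite -[X in ln X](addrNK 1) addrC le_ln1Dx // ltrBrDr addNr.
Qed.

Lemma drift1 : drift R 1 = 0.
Proof.
by rewrite /drift harmonic_sumS /harmonic_sum big_ord0 add0r invr1 mul1r subrr mul0r.
Qed.

Lemma drift_le m : (0 < m)%N -> drift R m <= ln m%:R + 1.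
Proof.
case: m => // -[|m] _; first by rewrite drift1 ln1 add0r.
rewrite /drift.
rewrite (maxn_idPr _) //= ler_pdivrMr //.
have := harmonic_sum_le (ltn0Sn m.+1).
have := ln_le_subr1 (x := m.+2%:R) (ltr0Sn _ _).
have : m.+2%:R = m.+1%:R + 1 :> R by rewrite natr1.
have : 0 < m.+1%:R :> R by [].
move: (m.+1%:R) (m.+2%:R) (H _) (ln _) => a b h l; nra.
Qed.

Lemma drift_ge m : (0 < m)%N -> ln m%:R - 1 <= drift R m.
Proof.
case: m => // -[|m] _; first by rewrite drift1 ln1 add0r lerN10.
rewrite /drift.
rewrite (maxn_idPr _) //= ler_pdivlMr //.
have := harmonic_sum_ge m.+2.
have : ln (m.+2%:R : R) <= ln m.+3%:R by rewrite ler_ln ?posrE // ler_nat.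
have := harmonic_sum_ge1 R (ltn0Sn m.+1).
have : m.+2%:R = m.+1%:R + 1 :> R by rewrite natr1.
have : 0 < m.+1%:R :> R by [].
move: (m.+1%:R) (m.+2%:R) (H _) (ln _) (ln _) => a b h l l'; nra.
Qed.

End DriftBounds.

(** * Control of the chain at the times of a grid of mesh 1 / N *)

Section LawOfLargeNumbers.
Variables (R : realType) (n N : nat).
Local Notation V := 'I_n.+1.
Local Notation L := (ln (n%:R : R)).
Implicit Types (f : {ffun V -> V}) (s : seq V) (v : V).

Hypothesis N0 : (0 < N)%N.
Hypothesis n0 : (0 < n)%N.
(** Over n / L cuts, an error of 1 + ln N per cut in the drift costs at most n / (4 N) by [L_ge]. By
    [L_le], rounding by one cut or one vertex costs at most n / (2 N). *)
Hypothesis L_ge : 4 * N%:R * (1 + ln N%:R) <= L.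
Hypothesis L_le : 1 + L <= n%:R / (2 * N%:R).

Let Npos : 0 < N%:R :> R. Proof. by rewrite ltr0n. Qed.
Let npos : 0 < n%:R :> R. Proof. by rewrite ltr0n. Qed.
Let N1 : 1 <= N%:R :> R. Proof. by rewrite ler1n. Qed.
Let lnN : 0 <= ln (N%:R : R). Proof. by rewrite ln_ge0. Qed.
Let L4 : 4 * N%:R <= L.
Proof. by apply: le_trans L_ge; rewrite ler_peMr ?mulr_ge0 // lerDl. Qed.
Let Lpos : 0 < L. Proof. by apply: lt_le_trans L4; rewrite mulr_gt0. Qed.

Lemma compensator_le f s : parent_fun f ->
  compensator R f s <= (size s)%:R * (L + 2).
Proof.
move=> pf; elim: s => [|v s IH] /=; first by rewrite mul0r.
rewrite -natr1 mulrDl mul1r lerD //.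
have m0 : (0 < #|alive f s|)%N by apply/card_gt0P; exists ord0; exact: ord0_alive.
apply: (le_trans (drift_le R m0)).
suff hh : ln (#|alive f s|%:R : R) <= L + 1 by lra.
have -> : L + 1 = L + 1 * 1 by rewrite mulr1.
apply: (@le_trans _ _ (ln (n.+1%:R : R))).
  by rewrite ler_ln ?posrE ?ltr0n // ler_nat -[X in (_ <= X)%N]card_ord max_card.
rewrite -lerBlDl -ln_div ?posrE ?ltr0n // -natr1 mulrDl divff ?lt0r_neq0 // mul1r.
have i0 : 0 < n%:R^-1 :> R by rewrite invr_gt0.
apply: (le_trans (le_ln1Dx _)); first by lra.
by rewrite mulr1 invf_le1 // ler1n.
Qed.

(** The drift is close to [L] only while many vertices remain; the number of vertices decreases in
    time, so it is enough to bound the final one. *)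
Lemma compensator_ge f s : parent_fun f ->
  n%:R / N%:R <= #|alive f s|%:R :> R ->
  (size s)%:R * (L - (1 + ln N%:R)) <= compensator R f s.
Proof.
move=> pf; elim: s => [|v s IH] hs /=; first by rewrite mul0r.
have le_alive : (#|alive f (v :: s)| <= #|alive f s|)%N.
  by apply: subset_leq_card; apply/fintype.subsetP => w; exact: alive_consP.
have {}hs : n%:R / N%:R <= #|alive f s|%:R :> R.
  by apply: (le_trans hs); rewrite ler_nat.
have m0 : (0 < #|alive f s|)%N by apply/card_gt0P; exists ord0; exact: ord0_alive.
rewrite -natr1 mulrDl mul1r lerD ?IH //.
apply: le_trans (drift_ge R m0).
suff hh : L - ln N%:R <= ln (#|alive f s|%:R : R) by lra.
by rewrite -ln_div ?posrE // ler_ln ?posrE ?divr_gt0 ?ltr0n.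
Qed.

(** The number of cuts made by rescaled time j / N. *)
Definition grid j : nat := Num.truncn (j%:R * n%:R / (N%:R * L) : R).

Let gridP j : (grid j)%:R <= (j%:R * n%:R / (N%:R * L) : R) < (grid j).+1%:R.
Proof. by apply: truncn_itv; rewrite divr_ge0 ?mulr_ge0 // ltW. Qed.

Let grid_le j : (grid j)%:R * L <= j%:R / N%:R * n%:R.
Proof.
have /andP[+ _] := gridP j; rewrite ler_pdivlMr ?mulr_gt0 // => h.
rewrite mulrAC ler_pdivlMr //; lra.
Qed.

Let grid_gt j : j%:R / N%:R * n%:R < ((grid j)%:R + 1) * L.
Proof.
have /andP[_] := gridP j; rewrite ltr_pdivrMr ?mulr_gt0 // -natr1 => h.
rewrite mulrAC ltr_pdivrMr //; lra.
Qed.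

Lemma gridS j : (grid j <= grid j.+1)%N.
Proof.
apply: le_truncn; rewrite ler_pM2r ?invr_gt0 ?mulr_gt0 //.
by rewrite ler_pM2r // ler_nat.
Qed.

Lemma grid_mono i j : (i <= j)%N -> (grid i <= grid j)%N.
Proof.
by move=> /subnK <-; elim: (j - i)%N => // k IH; rewrite (leq_trans IH) // gridS.
Qed.

Lemma grid_le_n : (grid N <= n)%N.
Proof.
have := grid_le N; rewrite divff ?lt0r_neq0 // mul1r => h.
rewrite -(ler_nat R); apply: le_trans h; rewrite ler_peMr //.
by apply: le_trans L4; have := N1; lra.
Qed.

Lemma alive_concentration f s j : parent_fun f -> (j <= N)%N -> size s = grid j ->
  `|martingale R f s| <= n%:R / (4 * N%:R) ->
  `|#|alive f s|%:R - (1 - j%:R / N%:R) * n%:R| <= n%:R / N%:R :> R.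
Proof.
move=> pf jN ss; set q := n%:R / N%:R.
have qE : n%:R / (4 * N%:R) = q / 4 by rewrite /q; field; rewrite lt0r_neq0.
have q2E : n%:R / (2 * N%:R) = q / 2 by rewrite /q; field; rewrite lt0r_neq0.
have qn : q * N%:R = n%:R by rewrite /q divfK // lt0r_neq0.
rewrite qE /martingale; set S : R := #|alive f s|%:R.
have := compensator_le s pf; have := @compensator_ge f s pf.
rewrite ss -/S -/q; set c := compensator R f s.
move=> c_ge c_le; rewrite !ler_norml => /andP[M1 M2].
have := grid_le j; have := grid_gt j; set k : R := (grid j)%:R.
set x : R := j%:R / N%:R; move=> kL1 kL2.
have x0 : 0 <= x by rewrite divr_ge0.
have x1 : x <= 1 by rewrite ler_pdivrMr // mul1r ler_nat.
have k0 : 0 <= k by [].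
have q0 : 0 < q by rewrite divr_gt0.
move: L_le; rewrite q2E => Lq.
have nE : n.+1%:R = n%:R + 1 :> R by rewrite natr1.
have kN : k * (4 * N%:R) <= n%:R.
  apply: (@le_trans _ _ (k * L)); first by rewrite ler_wpM2l.
  by apply: (le_trans kL2); rewrite ler_piMl // ltW.
have kq : 4 * k <= q.
  by rewrite /q ler_pdivlMr //; lra.
apply/andP; split; first by lra.
(* If fewer than [q] vertices remain, the upper bound is immediate; otherwise the lower bound on the
   compensator applies. *)
have [Sq|Sq] := ltP S q.
  have xn : x * n%:R <= n%:R by rewrite ler_piMl // ltW.
  by lra.
have {}c_ge := c_ge Sq.
have kc : k * (1 + ln N%:R) * 4 <= q.
  rewrite /q ler_pdivlMr //.
  apply: (@le_trans _ _ (k * L)); last first.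
    by apply: (le_trans kL2); rewrite ler_piMl // ltW.
  have h := ler_wpM2l k0 L_ge; lra.
by lra.
Qed.

(** Removal times start at 0, hence the successor: it counts the cuts up to and including the one
    that removes [v]. *)
Definition scaled_time s f v : R := (removal_time f (rev s) v).+1%:R * L / n%:R.

Definition scaled_rank s f v : R := (rank (removal_time f (rev s)) v)%:R / n.+1%:R.

Lemma scaled_time_rank f s v : parent_fun f -> size s = grid N ->
  (forall j, (j <= N)%N ->
    `|martingale R f (drop (grid N - grid j) s)| <= n%:R / (4 * N%:R)) ->
  `|scaled_time s f v - scaled_rank s f v| <= 5 / N%:R.
Proof.
move=> pf ss hM; set t := removal_time f (rev s).
pose C k := #|[set w | (t w < k)%N]%SET|.
have aliveC k : (k <= grid N)%N ->
    #|alive f (drop (grid N - k) s)|%:R = n.+1%:R - (C k)%:R :> R.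
  move=> kK; have -> : alive f (drop (grid N - k) s) = (~: [set w | (t w < k)%N])%SET.
    rewrite -alive_rev rev_drop ss subKn //; apply/setP => w.
    by rewrite alive_take ?size_rev ?ss // !inE -leqNgt.
  by rewrite cardsCs finset.setCK natrB ?card_ord // -[X in (_ <= X)%N]card_ord max_card.
have conc j : (j <= N)%N ->
    `|n.+1%:R - (C (grid j))%:R - (1 - j%:R / N%:R) * n%:R| <= n%:R / N%:R :> R.
  move=> jN; rewrite -aliveC ?grid_mono //; apply: alive_concentration => //.
    by rewrite size_drop ss subKn // grid_mono.
  exact: hM.
have rankC k : (rank t v < C k)%N = (t v < k)%N := rank_lt_card t v k.
have rank_n : (rank t v)%:R <= n%:R :> R by rewrite ler_nat -ltnS rank_lt.
rewrite /scaled_time /scaled_rank -/t.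
set r : R := (rank t v)%:R in rank_n *.
have n1E : n.+1%:R = n%:R + 1 :> R by rewrite natr1.
have tE : (t v).+1%:R = (t v)%:R + 1 :> R by rewrite natr1.
have n1pos : 0 < n.+1%:R :> R by [].
set q : R := n%:R / N%:R.
have qN : N%:R^-1 * n%:R = q by rewrite mulrC.
have iN : 0 < N%:R^-1 :> R by rewrite invr_gt0.
have q2E : n%:R / (2 * N%:R) = q / 2 by rewrite /q; field; rewrite lt0r_neq0.
have Lq : 1 + L <= q / 2 by rewrite -q2E.
have L0 : 0 < L := Lpos.
(* With [x] the grid time preceding the removal, the scaled time lies between x and x + 1 / N, and
   the scaled rank between x - 1 / N and x + 3 / N. *)
suff [x [x0 x1 h1 h2]] : exists x : R, [/\ 0 <= x, x <= 1,
    x * n%:R <= ((t v)%:R + 1) * L <= x * n%:R + q &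
    x * n%:R + 1 - q <= r <= x * n%:R + 1 + 2 * q].
  have {}h1 : x <= ((t v)%:R + 1) * L / n%:R <= x + N%:R^-1.
    rewrite ler_pdivlMr // ler_pdivrMr //; move: h1 => /andP[h1 h3].
    by apply/andP; split; lra.
  have {}h2 : x - N%:R^-1 <= r / n.+1%:R <= x + 3 / N%:R.
    rewrite ler_pdivlMr // ler_pdivrMr // n1E.
    by move: h2 => /andP[h2 h3]; apply/andP; split; lra.
  rewrite tE ler_norml; move: h1 h2; move: (_ / n%:R) (r / _) => y z.
  by move=> /andP[a1 a2] /andP[b1 b2]; apply/andP; split; lra.
have grid0 : grid 0 = 0%N.
  by rewrite /grid !mul0r truncn0.
(* The vertices that survive all the cuts are treated with x = 1. *)
have [tK|tK] := ltnP (t v) (grid N); last first.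
  have tvE : t v = grid N.
    by apply/eqP; rewrite eqn_leq tK andbT -ss -size_rev removal_time_le.
  exists 1; split=> //.
    rewrite tvE; have := grid_gt N; have := grid_le N.
    by rewrite divff ?lt0r_neq0 // => g1 g2; apply/andP; split; lra.
  have := conc N (leqnn N); rewrite divff ?lt0r_neq0 // subrr mul0r subr0.
  rewrite ler_norml -/q => /andP[_ c2].
  have : (C (grid N))%:R <= r by rewrite ler_nat leqNgt rankC -leqNgt.
  by move=> ?; apply/andP; split; nra.
have [j [jN jt tj]] : exists j, [/\ (j < N)%N, (grid j <= t v)%N & (t v < grid j.+1)%N].
  have ex : exists j, (t v < grid j)%N by exists N.
  case: (ex_minnP ex) => -[|j] tj jmin; first by rewrite grid0 in tj.
  exists j; split=> //; first exact: jmin.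
  by rewrite leqNgt; apply/negP => /jmin; rewrite ltnn.
exists (j%:R / N%:R); split.
- by rewrite divr_ge0.
- by rewrite ler_pdivrMr // mul1r ler_nat ltnW.
- have := grid_gt j; have := grid_le j.+1.
  have : (grid j)%:R <= (t v)%:R :> R by rewrite ler_nat.
  have : (t v)%:R + 1 <= (grid j.+1)%:R :> R by rewrite natr1 ler_nat.
  rewrite -[j.+1%:R]natr1 mulrDl mulrDl mul1r qN => a1 a2 a3 a4.
  by apply/andP; split; nra.
- have := conc j (ltnW jN); have := conc j.+1 jN; rewrite !ler_norml -/q.
  rewrite -[j.+1%:R]natr1 mulrDl mul1r => /andP[a1 _] /andP[_ a4].
  have : (C (grid j))%:R <= r by rewrite ler_nat leqNgt rankC -leqNgt.
  have : r <= (C (grid j.+1))%:R by rewrite ler_nat ltnW // rankC.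
  by move=> ? ?; apply/andP; split; nra.
Qed.

(** A union bound over the N + 1 grid times: by Chebyshev each costs at most (n / L) (2 n) / (n / (4
    N))^2 = 32 N^2 / L. *)
Lemma scaled_time_rank_prob :
  chain_mean (grid N) (fun f s =>
    (~~ [forall v, `|scaled_time s f v - scaled_rank s f v| <= 5 / N%:R])%R%:R)
  <= 32 * N%:R ^+ 2 * N.+1%:R / L.
Proof.
pose e : R := n%:R / (4 * N%:R).
have e0 : 0 < e by rewrite divr_gt0 // mulr_gt0.
apply: (@le_trans _ _ (chain_mean (grid N) (fun f s => \sum_(j < N.+1)
    (e <= `|martingale R f (drop (grid N - grid j) s)|)%R%:R))).
  apply: chain_mean_le => f s pf ss _.
  case: (boolP [forall v, _]) => [_|/forallPn[v vP]]; first exact: sumr_ge0.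
  have [j hj] : exists j : 'I_N.+1,
      e <= `|martingale R f (drop (grid N - grid j) s)|.
    apply/not_existsP => hn; case/negP: vP; apply: scaled_time_rank => // j jN.
    have /negP := hn (Ordinal (jN : (j < N.+1)%N)).
    by rewrite -ltNge => /ltW.
  by rewrite (bigD1 j) //= hj lerDl sumr_ge0.
rewrite chain_mean_sum.
have -> : 32 * N%:R ^+ 2 * N.+1%:R / L = \sum_(j < N.+1) 32 * N%:R ^+ 2 / L :> R.
  by rewrite sumr_const card_ord -[RHS]mulr_natr; field; rewrite lt0r_neq0.
apply: ler_sum => j _.
have jN : (grid j <= grid N)%N by apply: grid_mono; rewrite -ltnS.
rewrite -{1}(subnK jN) (chain_mean_drop _ _
  (fun f s => (e <= `|martingale R f s|)%R%:R)).
apply: (le_trans (chain_chebyshev n _ e0)).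
rewrite natrM ler_pdivrMr ?exprn_gt0 //.
have := grid_le N; rewrite divff ?lt0r_neq0 // mul1r.
have : (grid j)%:R <= (grid N)%:R :> R by rewrite ler_nat.
have : n.+1%:R <= 2 * n%:R :> R by rewrite -natrM ler_nat; lia.
have -> : 32 * N%:R ^+ 2 / L * e ^+ 2 = 2 * n%:R * (n%:R / L).
  by rewrite /e; field; rewrite !lt0r_neq0.
move=> h1 h2 h3; rewrite mulrC; apply: ler_pM => //.
by rewrite ler_pdivlMr //; apply: le_trans h3; rewrite ler_pM2r.
Qed.

End LawOfLargeNumbers.

(** * Complete runs of the algorithm *)

Section FiniteValued.
Context d (Omega : measurableType d) (R : realType) (P : probability Omega R).
Variables (S : finType) (Y : Omega -> S).
Hypothesis mY : discrete_rv Y.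

Definition pmf (y : S) : R := fine (P (Y @^-1` [set y])).

Let pmfE y : P (Y @^-1` [set y]) = (pmf y)%:E.
Proof. by rewrite /pmf fineK // fin_num_measure //; exact: mY. Qed.

Lemma pmf_ge0 y : 0 <= pmf y.
Proof. exact: fine_ge0. Qed.

Lemma preimage_bigsetU (B : pred S) : Y @^-1` [set y | B y] =
  \big[setU/set0]_(y <- enum B) (Y @^-1` [set y]).
Proof.
apply/seteqP; split => w /=; rewrite -bigcup_seq /=.
  by move=> Bw; exists (Y w) => //=; rewrite mem_enum.
by move=> [y] /=; rewrite mem_enum => By ->.
Qed.

Let trivY (D : set S) : trivIset D (fun y => Y @^-1` [set y]).
Proof. by move=> y z _ _ [w /= [<- <-]]. Qed.

Lemma measurable_preimage_finite (B : pred S) : measurable (Y @^-1` [set y | B y]).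
Proof. by rewrite preimage_bigsetU; apply: bigsetU_measurable => y _; exact: mY. Qed.

Lemma probability_preimage (B : pred S) :
  P (Y @^-1` [set y | B y]) = (\sum_(y | B y) pmf y)%:E.
Proof.
rewrite preimage_bigsetU -big_enum /=.
elim: (enum B) (enum_uniq B) => [|y s IH] /=; first by rewrite !big_nil measure0.
move=> /andP[ys us]; rewrite !big_cons EFinD -IH // -pmfE; apply: measureU.
- exact: mY.
- by apply: bigsetU_measurable => z _; exact: mY.
- apply/seteqP; split => // w [/= wy]; rewrite -bigcup_seq => -[z /= zs wz].
  by move: ys; rewrite -wy wz zs.
Qed.

Lemma sum_pmf : \sum_y pmf y = 1.
Proof.
have := probability_preimage xpredT.
rewrite (_ : _ @^-1` _ = setT); last by apply/seteqP; split.
by rewrite probability_setT => -[].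
Qed.

Lemma measurable_fun_finite (g : S -> R) : measurable_fun setT (g \o Y).
Proof.
move=> _ A mA; rewrite setTI.
rewrite (_ : _ @^-1` A = Y @^-1` [set y | `[< A (g y) >]]).
  exact: measurable_preimage_finite.
by apply/seteqP; split => w /=; [move/asboolT|move/asboolP].
Qed.

Lemma expectation_finite (g : S -> R) :
  ('E_P[g \o Y] = (\sum_y g y * pmf y)%:E)%E.
Proof.
rewrite unlock; have := preimage_bigsetU xpredT.
rewrite (_ : _ @^-1` _ = setT); last by apply/seteqP; split.
move=> TE; rewrite TE integral_bigsetU_EFin ?enum_uniq //=.
- rewrite big_enum /= -sumEFin; apply: eq_bigr => y _.
  rewrite (eq_integral (cst (g y)%:E)); last by move=> w; rewrite inE /= => ->.
  rewrite integral_cst; last exact: mY.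
  by rewrite EFinM -pmfE.
- by rewrite -TE; apply/measurable_EFinP; exact: measurable_fun_finite.
Qed.

End FiniteValued.

Lemma uniq_map_inj_in (A B : eqType) (F : A -> B) (s : seq A) : uniq (map F s) ->
  {in s &, injective F}.
Proof.
elim: s => //= a s IH /andP[nF us] x y; rewrite !inE.
move=> /orP[/eqP ->|xs] /orP[/eqP ->|ys] // e.
- by move: nF; rewrite e map_f.
- by move: nF; rewrite -e map_f.
- exact: IH.
Qed.

(** * Runs that end when the sample is disconnected *)

Section GoodRuns.
Variables (n l : nat) (hl : (2 <= l)%N).
Local Notation V := 'I_n.+1.
Implicit Types (f : {ffun V -> V}) (u : l.-tuple V) (h s : seq V).

Definition sorted_times f h u : seq nat := sort leq (map (removal_time f h) u).

(* [h] ends with the cut that completes the disconnection of [u]. *)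
Definition complete_run f h u : bool :=
  uniq (map (removal_time f h) u) && (size h == (nth 0 (sorted_times f h u) l.-2).+1)%N.

Lemma size_sorted_times f h u : size (sorted_times f h u) = l.
Proof. by rewrite size_sort size_map size_tuple. Qed.

Lemma sorted_times_lt f h u i j : uniq (map (removal_time f h) u) ->
  (i < j < l)%N -> (nth 0 (sorted_times f h u) i < nth 0 (sorted_times f h u) j)%N.
Proof.
move=> uu /andP[ij jl].
have ss : sorted <%O (sorted_times f h u).
  by rewrite lt_sorted_uniq_le sort_uniq uu; exact: (sort_sorted leq_total).
have := @lt_sorted_ltn_nth _ _ 0%N _ ss i j.
by rewrite !inE size_sorted_times jl (ltn_trans ij jl) => /(_ isT isT); rewrite ij.
Qed.

Lemma sorted_times_le f h u i : (i < l)%N ->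
  (nth 0 (sorted_times f h u) i <= size h)%N.
Proof.
move=> il; have : nth 0%N (sorted_times f h u) i \in sorted_times f h u.
  by rewrite mem_nth // size_sorted_times.
by rewrite mem_sort => /mapP[v _ ->]; exact: removal_time_le.
Qed.

Lemma sorted_times_take f h u k : (k <= size h)%N ->
  sorted_times f (take k h) u = map (minn^~ k) (sorted_times f h u).
Proof.
move=> kh; apply: (sorted_eq leq_trans anti_leq).
- exact: (sort_sorted leq_total).
- apply: (homo_sorted (e := leq)); last exact: (sort_sorted leq_total).
  by move=> x y xy; rewrite leq_min geq_minr andbT geq_min xy.
- rewrite perm_sort perm_sym /sorted_times.
  apply: (perm_trans (perm_map _ (permEl (perm_sort _ _)))).
  rewrite -map_comp (@eq_map _ _ _ (removal_time f (take k h))) // => v /=.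
  by rewrite removal_time_take.
Qed.

(** Truncating just after the second largest removal time turns the largest one into the length of
    the run. The times stay distinct and the first [l.-1] of them are unchanged. *)
Lemma complete_run_take f h u :
  uniq (map (removal_time f h) u) ->
  let k := (nth 0 (sorted_times f h u) l.-2).+1%N in
  [/\ (k <= size h)%N, complete_run f (take k h) u &
    forall i, (i < l.-1)%N ->
      nth 0%N (sorted_times f (take k h) u) i = nth 0%N (sorted_times f h u) i].
Proof.
move=> uu k; have l2 : (l.-2 < l.-1 < l)%N by lia.
have l1 : (l.-1 < l)%N by lia.
have kh : (k <= size h)%N.
  exact: leq_trans (sorted_times_lt uu l2) (sorted_times_le f h u l1).
have E i : (i < l.-1)%N ->
    nth 0%N (sorted_times f (take k h) u) i = nth 0%N (sorted_times f h u) i.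
  move=> il; rewrite sorted_times_take // (nth_map 0%N) ?size_sorted_times; last by lia.
  apply/minn_idPl/ltnW; rewrite ltnS; have [->//|i2] := eqVneq i l.-2.
  by apply/ltnW/sorted_times_lt => //; lia.
split=> //; rewrite /complete_run size_takel // E ?eqxx ?andbT; last by lia.
have -> : map (removal_time f (take k h)) u = map (minn^~ k) (map (removal_time f h) u).
  by rewrite -map_comp; apply: eq_map => v /=; rewrite removal_time_take.
rewrite -(perm_uniq (perm_map _ (permEl (perm_sort leq _)))) -/(sorted_times f h u).
rewrite -sorted_times_take //; apply/(uniqP 0%N) => i j; rewrite !inE.
rewrite !size_sorted_times => il jl; wlog : i j il jl / (i <= j)%N.
  by move=> W; case: (leqP i j) => [|/ltnW] /W h1 h2; [exact: h1|apply/esym/h1].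
move=> ij e; apply/eqP; rewrite eqn_leq ij leqNgt; apply/negP => ij'.
have [jl1|jl1] := ltnP j l.-1.
  have := sorted_times_lt uu (i := i) (j := j).
  by rewrite -!E ?e ?ltnn ?ij' ?jl // => [/(_ isT)//|]; lia.
have jE : j = l.-1 by lia.
have il1 : (i < l.-1)%N by lia.
move: e; rewrite E // jE sorted_times_take // (nth_map 0%N) ?size_sorted_times //.
rewrite (minn_idPr _); last exact: (sorted_times_lt uu l2).
rewrite /k => e; have [i2|i2] := eqVneq i l.-2; first by rewrite i2 in e; lia.
have := sorted_times_lt uu (i := i) (j := l.-2); rewrite e; lia.
Qed.

Section CompleteRun.
Variables (R : realFieldType) (f : {ffun V -> V}) (h : seq V) (u : l.-tuple V).
Hypotheses (pf : parent_fun f) (cr : complete_run f h u).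

(** The two vertices removed last are both alive before the final cut, so the algorithm has not
    stopped and the chain is not idle. *)
Lemma complete_run_two_alive i : (i < size h)%N ->
  exists v w, [/\ v \in u, w \in u, v != w, v \in alive f (take i h)
    & w \in alive f (take i h)].
Proof.
move: cr => /andP[uu /eqP hk] ih.
have l2 : (l.-2 < l.-1 < l)%N by lia.
have get j : (j < l)%N -> exists2 v, v \in u & removal_time f h v = nth 0%N (sorted_times f h u) j.
  move=> jl; have : nth 0%N (sorted_times f h u) j \in sorted_times f h u.
    by rewrite mem_nth // size_sorted_times.
  by rewrite mem_sort => /mapP[v vu ->]; exists v.
have [v vu vE] : exists2 v, v \in u & removal_time f h v = nth 0%N (sorted_times f h u) l.-2.
  by apply: get; lia.
have [w wu wE] : exists2 v, v \in u & removal_time f h v = nth 0%N (sorted_times f h u) l.-1.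
  by apply: get; lia.
have lt_vw : (removal_time f h v < removal_time f h w)%N.
  by rewrite vE wE; exact: sorted_times_lt.
have iv : (i <= removal_time f h v)%N by rewrite vE -ltnS -hk.
exists v, w; rewrite !alive_take ?(ltnW ih) // iv (leq_trans iv (ltnW lt_vw)).
by split=> //; apply: contraTneq lt_vw => ->; rewrite ltnn.
Qed.

Lemma complete_run_candidates i : (i < size h)%N ->
  candidates (alive f (take i h)) = (alive f (take i h) :\ ord0)%SET.
Proof.
move=> ih; rewrite /candidates; case: eqP => // A1.
have [v [w [_ _]]] := complete_run_two_alive ih.
by rewrite A1 !inE => vw /eqP v0 /eqP w0; rewrite v0 w0 eqxx in vw.
Qed.

Lemma chain_weight_take i : (i < size h)%N ->
  chain_weight R f (rev (take i.+1 h)) = chain_weight R f (rev (take i h))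
    * (nth ord0 h i \in candidates (alive f (take i h)))%:R
    / #|candidates (alive f (take i h))|%:R.
Proof.
by move=> ih; rewrite (take_nth ord0 ih) rev_rcons /= !alive_rev.
Qed.

Lemma chain_weight_take_neq0 i : chain_weight R f (rev h) != 0 -> (i <= size h)%N ->
  chain_weight R f (rev (take i h)) != 0.
Proof.
move=> w0 ih; have := subKn ih; move: (size h - i)%N => j <-.
elim: j => [|j IH]; first by rewrite subn0 take_size.
have [hj|hj] := leqP (size h) j.
  by rewrite (_ : size h - j.+1 = size h - j)%N //; lia.
have E : ((size h - j.+1).+1 = size h - j)%N by lia.
apply: contraNneq IH => w1; rewrite -E chain_weight_take ?w1 ?mul0r //; lia.
Qed.

Lemma complete_run_root_cuts : chain_weight R f (rev h) != 0 -> root_cuts f h.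
Proof.
move=> w0 i ih; have := chain_weight_take_neq0 w0 ih.
rewrite chain_weight_take // complete_run_candidates //.
have [|_] := boolP (nth ord0 h i \in _); last by rewrite mulr0 mul0r eqxx.
by rewrite in_setD1 => /andP[].
Qed.

End CompleteRun.

End GoodRuns.

(** * Comparison with the root chain *)

Local Arguments mkseq : simpl never.

Section Comparison.
Context d (Omega : measurableType d) (R : realType) (P : probability Omega R).
Variables (n l : nat) (hl : (2 <= l)%N).
Local Notation V := 'I_n.+1.
Variables (T : Omega -> {set {set V}}) (U : Omega -> l.-tuple V)
  (C : nat -> Omega -> {set V}).
Hypothesis D : disconnection P T U C.
Implicit Types (f : {ffun V -> V}) (u : l.-tuple V) (h s : seq V).

Lemma measurable_mkseq k (c : seq {set V}) :
  measurable [set w | mkseq (C^~ w) k = c].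
Proof.
elim: k c => [|k IH] c.
  case: c => [|e c]; last by rewrite (_ : [set _ | _] = set0) //; apply/seteqP; split.
  by rewrite (_ : [set _ | _] = setT) //; apply/seteqP; split.
case/lastP: c => [|c e].
  by rewrite (_ : [set _ | _] = set0) //; apply/seteqP; split.
rewrite (_ : [set _ | _] = [set w | mkseq (C^~ w) k = c] `&` (C k @^-1` [set e])).
  by apply: measurableI; [exact: IH|exact: (disconnection_rvC D)].
apply/seteqP; split => w /=; rewrite mkseqS; first by move=> /rcons_inj[-> ->].
by move=> [-> ->].
Qed.

(** The first [n] cuts suffice, since [disconnection_time] examines at most [n] of them. *)
Definition joint (w : Omega) : {set {set V}} * l.-tuple V * n.-tuple {set V} :=
  (T w, U w, [tuple of mkseq (C^~ w) n]).

Lemma measurable_joint : discrete_rv joint.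
Proof.
move=> [[t u] c]; rewrite (_ : _ @^-1` _ = (T @^-1` [set t] `&` U @^-1` [set u])
    `&` [set w | mkseq (C^~ w) n = c]).
  apply: measurableI; last exact: measurable_mkseq.
  by apply: measurableI; [exact: (disconnection_rvT D)|exact: (disconnection_rvU D)].
apply/seteqP; split => w /=; first by move=> [-> -> <-].
by move=> [[<- <-] e]; congr (_, _, _); apply: val_inj.
Qed.

Local Notation npar := (#|[set f | @parent_fun n f]%SET|%:R : R).
Local Notation nsamples := (#|[set u : l.-tuple V | uniq u]%SET|%:R : R).

(** Along a complete run, the kept edges correspond to the candidates of the chain, so both
    processes have the same transition probabilities. *)
Lemma law_of_run f h u k : parent_fun f -> complete_run f h u ->
  chain_weight R f (rev h) != 0 -> (k <= size h)%N ->
  P [set w | [/\ T w = edges f, U w = u & mkseq (C^~ w) k = map (edge f) (take k h)]]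
  = (npar^-1 * nsamples^-1 * chain_weight R f (rev (take k h)))%:E.
Proof.
move=> pf cr w0; have rh := complete_run_root_cuts hl pf cr w0.
have uu : uniq (map (removal_time f h) u) by case/andP: cr.
elim: k => [_|k IH kh].
  rewrite take0 /= mulr1 (_ : [set _ | _] = [set w | T w = edges f /\ U w = u]).
    rewrite (disconnection_TU D) (disconnection_T D) (disconnection_U D).
    rewrite inE (map_uniq uu) card_increasing_trees increasing_treesE.
    rewrite (_ : edges f \in _); last by apply: imset_f; rewrite inE.
    by rewrite EFinM.
  by apply/seteqP; split => w /=; [move=> []|move=> [-> ->]].
have kh' := ltnW kh.
set e := edge f (nth ord0 h k).
have [hk0 hkA] := rh k kh.
have rk := root_cuts_take (k := k) rh.
have keptE := @kept_edgesE _ f (take k h) l u pf rk.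
rewrite size_takel // in keptE.
have kept : kept_edges (edges f) u (map (edge f) (take k h))
    = [set edge f v | v in alive f (take k h) :\ ord0]%SET.
  apply: keptE; last exact: complete_run_two_alive.
  (* Truncated times that agree below [k] are genuine times, which are distinct on [u]. *)
  move=> v w vu wu; rewrite !removal_time_take // => e1 e2.
  apply: (uniq_map_inj_in uu) => //; move: e1 e2.
  by rewrite /minn; do 2!case: ifP => ?; rewrite ?ltnn //; lia.
have ek : e \in kept_edges (edges f) u (map (edge f) (take k h)).
  by rewrite kept; apply: imset_f; rewrite in_setD1 hk0.
have DC := disconnection_C D k ek.
rewrite (_ : [set _ | _] = [set w | [/\ T w = edges f, U w = u,
    mkseq (C^~ w) k = [seq edge f i | i <- take k h] & C k w = e]]); last first.
  rewrite (take_nth ord0 kh) map_rcons.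
  apply/seteqP; split => w /=; rewrite mkseqS.
    by move=> [-> -> /rcons_inj[-> ->]].
  by move=> [-> -> -> ->].
rewrite DC IH // kept card_alive_edges // -EFinM; congr EFin.
rewrite chain_weight_take // (complete_run_candidates hl pf cr kh) in_setD1 hk0 hkA mulr1.
rewrite (cardsD1 ord0 (alive f (take k h))) ord0_alive // add1n /=.
by rewrite !mulrA.
Qed.

(** Compares sampling without and with replacement; the second alternative is excluded as soon as
    some sample exists. *)
Lemma nsamples_le : (n.+1%:R ^- l : R) <= nsamples^-1 \/ nsamples = 0.
Proof.
have [->|s0] := eqVneq nsamples 0; [by right|left].
have p0 : 0 < nsamples by rewrite lt0r s0 ler0n.
have q0 : 0 < n.+1%:R ^+ l :> R by rewrite exprn_gt0.
rewrite lef_pV2 ?posrE //.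
by rewrite -natrX ler_nat -[X in (_ <= X ^ _)%N](card_ord n.+1) -card_tuple max_card.
Qed.

Definition times_of (y : {set {set V}} * l.-tuple V * n.-tuple {set V}) :
    {ffun 'I_l.-1 -> 'I_n.+2} :=
  [ffun i : 'I_l.-1 => inord (disconnection_time y.1.1 y.1.2
    (nth finset.set0 y.2) i.+2)].

Definition chain_times f h u : {ffun 'I_l.-1 -> 'I_n.+2} :=
  [ffun i : 'I_l.-1 => inord (nth 0 (sorted_times f h u) i).+1].

Lemma last_index_subproof : (l.-2 < l.-1)%N. Proof. by lia. Qed.
Let last_index : 'I_l.-1 := Ordinal last_index_subproof.

(* A lower bound is enough: both sides define laws, so that the total variation
   distance is controlled by the mass of incomplete runs. *)
Lemma law_lower_bound (a : {ffun 'I_l.-1 -> 'I_n.+2}) k : (k <= n)%N ->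
  chain_mean k (fun f s => n.+1%:R ^- l * \sum_(u : l.-tuple V)
    (complete_run f (rev s) u && (chain_times f (rev s) u == a))%:R)
  <= \sum_(y | times_of y == a) pmf P joint y :> R.
Proof.
move=> kn.
pose good (o : {ffun V -> V} * k.-tuple V * l.-tuple V) :=
  [&& parent_fun o.1.1, complete_run o.1.1 (rev o.1.2) o.2,
    chain_times o.1.1 (rev o.1.2) o.2 == a & chain_weight R o.1.1 o.1.2 != 0].
pose run (o : {ffun V -> V} * k.-tuple V * l.-tuple V)
    (y : {set {set V}} * l.-tuple V * n.-tuple {set V}) :=
  [&& y.1.1 == edges o.1.1, y.1.2 == o.2 &
    take k y.2 == map (edge o.1.1) (rev o.1.2)].
have runP o : good o -> npar^-1 * n.+1%:R ^- l * chain_weight R o.1.1 o.1.2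
    <= \sum_(y | run o y) pmf P joint y.
  case: o => [[f s] u] /and4P[/= pf cr _ w0].
  have sz : size (rev s) = k by rewrite size_rev size_tuple.
  have w0' : chain_weight R f (rev (rev s)) != 0 by rewrite revK.
  have := law_of_run pf cr w0' (leqnn (size (rev s))); rewrite take_size revK sz.
  rewrite (_ : [set _ | _] = joint @^-1` [set y | run (f, s, u) y]); last first.
    have takeE w : take k [tuple of mkseq (C^~ w) n] = mkseq (C^~ w) k.
      by rewrite /= /mkseq -map_take take_iota (minn_idPl kn).
    apply/seteqP; split => w /=; rewrite /run /= takeE.
      by move=> [-> -> ->]; rewrite !eqxx.
    by move=> /and3P[/eqP -> /eqP -> /eqP ->].
  rewrite (probability_preimage P measurable_joint) => -[->].
  rewrite -!mulrA ler_wpM2l ?invr_ge0 // ler_wpM2r ?chain_weight_ge0 //.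
  case: nsamples_le => // s0; exfalso.
  have : u \in [set u : l.-tuple V | uniq u]%SET.
    by rewrite inE; case/andP: cr => /map_uniq.
  by move/eqP: s0; rewrite pnatr_eq0 cards_eq0 => /eqP ->; rewrite inE.
have lhsE : chain_mean k (fun f s => n.+1%:R ^- l * \sum_(u : l.-tuple V)
    (complete_run f (rev s) u && (chain_times f (rev s) u == a))%:R)
  = \sum_(o | good o) npar^-1 * n.+1%:R ^- l * chain_weight R o.1.1 o.1.2.
  rewrite (eq_bigl (fun o : {ffun V -> V} * k.-tuple V * l.-tuple V =>
    (parent_fun o.1.1 && true) && [&& complete_run o.1.1 (rev o.1.2) o.2,
    chain_times o.1.1 (rev o.1.2) o.2 == a & chain_weight R o.1.1 o.1.2 != 0])); last first.
    by move=> o; rewrite /good andbT.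
  rewrite -(pair_big_dep (fun o : {ffun V -> V} * k.-tuple V => parent_fun o.1 && true)
    (fun o u => [&& complete_run o.1 (rev o.2) u,
      chain_times o.1 (rev o.2) u == a & chain_weight R o.1 o.2 != 0])
    (fun o u => npar^-1 * n.+1%:R ^- l * chain_weight R o.1 o.2)) /=.
  rewrite -(pair_big (fun f => parent_fun f) xpredT (fun f (s : k.-tuple V) =>
    \sum_(u | [&& complete_run f (rev s) u,
      chain_times f (rev s) u == a & chain_weight R f s != 0])
      npar^-1 * n.+1%:R ^- l * chain_weight R f s)) /=.
  rewrite /chain_mean mulr_sumr; apply: eq_bigr => f pf.
  rewrite mulr_sumr; apply: eq_bigr => s _.
  rewrite [RHS]big_mkcond !mulr_sumr /=; apply: eq_bigr => u _.
  rewrite andbA; case: (_ && _); rewrite /= ?mulr0 //.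
  case: eqP => [->|_] /=; rewrite ?mul0r ?mulr0 //.
  by rewrite mulr1 mulrA mulrAC.
rewrite lhsE; apply: (le_trans (ler_sum _ runP)).
rewrite (exchange_big_dep xpredT) //= [leRHS]big_mkcond /=; apply: ler_sum => y _.
rewrite sumr_const -mulr_natl; have p0 := pmf_ge0 P joint y.
set m := #|_|.
(* Distinct good runs are disjoint events: the edge sets determine the tree and the list of cuts. *)
have m1 : (m <= 1)%N.
  apply/card_le1_eqP => -[[f s] u] [[f' s'] u'].
  rewrite !unfold_in /= => /andP[/and4P[/= pf cr _ w0] /and3P[/= /eqP y1 /eqP y2 /eqP y3]].
  move=> /andP[/and4P[/= pf' cr' _ w0'] /and3P[/= /eqP y1' /eqP y2' /eqP y3']].
  have fE : f = f' by apply: edges_inj; rewrite // -y1 y1'.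
  have uE : u = u' by rewrite -y2 y2'.
  rewrite -fE in cr' w0' y3' *; rewrite -uE in cr' *.
  suff -> : s = s' by [].
  have rs : root_cuts f (rev s).
    by apply: (complete_run_root_cuts hl pf cr (R := R)); rewrite revK.
  have rs' : root_cuts f (rev s').
    by apply: (complete_run_root_cuts hl pf cr' (R := R)); rewrite revK.
  have sz (x : k.-tuple V) : size (rev x) = k by rewrite size_rev size_tuple.
  apply/val_inj/(can_inj revK)/(@eq_from_nth _ ord0); first by rewrite !sz.
  move=> i; rewrite sz => ik; apply: (edge_inj pf).
  - by case: (rs i); rewrite ?sz.
  - by case: (rs' i); rewrite ?sz.
  - have : nth finset.set0 (map (edge f) (rev s)) i = nth finset.set0 (map (edge f) (rev s')) i.
      by rewrite -y3 -y3'.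
    by rewrite !(nth_map ord0) ?sz.
case: ifPn => ya; first by rewrite ler_piMl // (ler_nat R m 1).
suff -> : m = 0%N by rewrite mul0r.
apply: eq_card0 => -[[f s] u]; rewrite [RHS]inE.
apply: contraNF ya; rewrite unfold_in /= => /andP[].
move=> /and4P[/= pf cr /eqP <- w0] /and3P[/= /eqP y1 /eqP y2 /eqP y3].
have rs : root_cuts f (rev s).
  by apply: (complete_run_root_cuts hl pf cr (R := R)); rewrite revK.
have sz : size (rev s) = k by rewrite size_rev size_tuple.
move: cr => /andP[uu /eqP hk].
apply/eqP/ffunP => i; rewrite !ffunE; congr inord; rewrite y1 y2.
have i1 : (i <= l.-2)%N by have := ltn_ord i; lia.
apply: disconnection_timeE => //.
- by rewrite sz.
- by rewrite sz -y3; apply: map_nth_iota0; rewrite size_tuple.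
- by have := ltn_ord i; lia.
- rewrite hk ltnS; have [->//|i2] := eqVneq (i : nat) l.-2.
  by apply/ltnW/sorted_times_lt => //; lia.
Qed.

(** The last coordinate of [a] is the length [k] of the complete run; the [K] cuts of the chain are
    truncated to the first [k]. *)
Lemma pmf_times_lower_bound (a : {ffun 'I_l.-1 -> 'I_n.+2}) K : (K <= n)%N ->
  chain_mean K (fun f s => n.+1%:R ^- l * \sum_(u : l.-tuple V)
    (uniq (map (removal_time f (rev s)) u) && (chain_times f (rev s) u == a))%:R)
  <= \sum_(y | times_of y == a) pmf P joint y :> R.
Proof.
move=> Kn; set k := nat_of_ord (a last_index).
have aE f (h : seq V) u : uniq (map (removal_time f h) u) -> size h = K ->
    chain_times f h u = a -> k = (nth 0 (sorted_times f h u) l.-2).+1.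
  move=> uu sh ca; rewrite /k -ca ffunE inordK //= !ltnS.
  by apply: leq_trans (sorted_times_le _ _ _ _) _; rewrite ?sh //; lia.
have [kK|Kk] := leqP k K; last first.
  rewrite (@chain_mean_eq _ _ _ _ (fun _ _ => 0)) ?chain_mean_cst.
    by apply: sumr_ge0 => y _; exact: pmf_ge0.
  move=> f s pf ss _; rewrite big1 ?mulr0 // => u _.
  have sz : size (rev s) = K by rewrite size_rev.
  have [uu|//] := boolP (uniq _); case: eqP => //= ca; exfalso.
  have [kh _ _] := complete_run_take hl uu.
  by move: kh; rewrite -(aE _ _ _ uu sz ca) sz leqNgt Kk.
apply: le_trans (law_lower_bound a (leq_trans kK Kn)).
rewrite -[leRHS](@chain_mean_drop R n (K - k) k) subnK //.
apply: chain_mean_le => f s pf ss _; rewrite ler_wpM2l ?invr_ge0 ?exprn_ge0 //.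
apply: ler_sum => u _; have sz : size (rev s) = K by rewrite size_rev.
have [uu|//] := boolP (uniq _); case: eqP => //= ca.
have [kh cr E] := complete_run_take hl uu.
rewrite rev_drop ss subKn // (aE _ _ _ uu sz ca) cr /=.
rewrite (_ : chain_times _ _ _ = a) ?eqxx // -ca; apply/ffunP => i.
by rewrite !ffunE E.
Qed.

(** The chain law [q] restricted to distinct times lies below the law [p] of the algorithm and
    misses only the mass of collisions. Replacing [p] by [q] costs [M] times this mass, and so does
    restoring the colliding samples. *)
Lemma law_comparison (phi : {ffun 'I_l.-1 -> 'I_n.+2} -> R) (M : R) K :
  (K <= n)%N -> (forall a, `|phi a| <= M) ->
  `|\sum_y phi (times_of y) * pmf P joint y
    - chain_mean K (fun f s => n.+1%:R ^- l * \sum_(u : l.-tuple V)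
        phi (chain_times f (rev s) u))|
  <= 2 * M * chain_mean K (fun f s => n.+1%:R ^- l * \sum_(u : l.-tuple V)
        (~~ uniq (map (removal_time f (rev s)) u))%:R).
Proof.
move=> Kn phiM.
have M0 : 0 <= M by apply: le_trans (phiM [ffun=> ord0]).
pose N : R := n.+1%:R ^- l.
have N0 : 0 <= N by rewrite invr_ge0 exprn_ge0.
pose p a : R := \sum_(y | times_of y == a) pmf P joint y.
pose q a : R := chain_mean K (fun f s => N * \sum_(u : l.-tuple V)
  (uniq (map (removal_time f (rev s)) u) && (chain_times f (rev s) u == a))%:R).
have qp a : q a <= p a by exact: pmf_times_lower_bound.
have sump : \sum_a p a = 1.
  rewrite /p -(sum_pmf P measurable_joint).
  by rewrite (partition_big times_of xpredT) //=.
set bad := chain_mean K (fun f s => N * \sum_(u : l.-tuple V)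
  (~~ uniq (map (removal_time f (rev s)) u))%:R).
have cardN : N * \sum_(u : l.-tuple V) 1 = 1.
  by rewrite /N sumr_const card_tuple card_ord natrX mulVf ?expf_neq0 ?pnatr_eq0.
have sumq (psi : {ffun 'I_l.-1 -> 'I_n.+2} -> R) : \sum_a psi a * q a
    = chain_mean K (fun f s => N * \sum_(u : l.-tuple V)
      psi (chain_times f (rev s) u) * (uniq (map (removal_time f (rev s)) u))%:R).
  rewrite (eq_bigr (fun a => chain_mean K (fun f s => psi a * (N * \sum_(u : l.-tuple V)
    (uniq (map (removal_time f (rev s)) u) && (chain_times f (rev s) u == a))%:R)))); last first.
    by move=> a _; rewrite chain_meanZ.
  rewrite -chain_mean_sum; apply: chain_mean_eq => f s _ _ _.
  under eq_bigr do rewrite mulrCA.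
  rewrite -mulr_sumr; congr (_ * _).
  under eq_bigr do rewrite mulr_sumr.
  rewrite exchange_big /=; apply: eq_bigr => u _.
  rewrite (bigD1 (chain_times f (rev s) u)) //= eqxx andbT big1 ?addr0 // => a.
  by rewrite eq_sym => /negbTE ->; rewrite andbF mulr0.
have sumq1 : \sum_a q a = 1 - bad.
  apply/eqP; rewrite -subr_eq opprK; apply/eqP.
  have := sumq (fun=> 1); under eq_bigr do rewrite mul1r.
  move=> ->; rewrite -[RHS](chain_mean_cst n K 1) -chain_meanD.
  apply: chain_mean_eq => f s _ _ _; rewrite -mulrDr -big_split /= -[RHS]cardN.
  by congr (_ * _); apply: eq_bigr => u _; rewrite mul1r; case: uniq; rewrite ?addr0 ?add0r.
have phip : \sum_y phi (times_of y) * pmf P joint y = \sum_a phi a * p a.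
  rewrite (partition_big times_of xpredT) //=; apply: eq_bigr => a _.
  by rewrite /p mulr_sumr; apply: eq_bigr => y /eqP ->.
rewrite phip; set E := chain_mean K _.
have h1 : `|\sum_a phi a * p a - \sum_a phi a * q a| <= M * bad.
  rewrite -sumrB (le_trans (ler_norm_sum _ _ _)) //.
  have -> : M * bad = \sum_a M * (p a - q a).
    by rewrite -mulr_sumr sumrB sump sumq1; ring.
  apply: ler_sum => a _; rewrite -mulrBr normrM ler_pM //.
  by rewrite ger0_norm // subr_ge0.
have h2 : `|\sum_a phi a * q a - E| <= M * bad.
  have -> : \sum_a phi a * q a - E = chain_mean K (fun f s => N * \sum_(u : l.-tuple V)
      - phi (chain_times f (rev s) u) * (~~ uniq (map (removal_time f (rev s)) u))%:R).
    apply/eqP; rewrite subr_eq; apply/eqP; rewrite sumq -chain_meanD.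
    apply: chain_mean_eq => f s _ _ _; rewrite -mulrDr -big_split /=; congr (_ * _).
    apply: eq_bigr => u _; case: uniq => /=; ring.
  have bnd (F : {ffun V -> V} -> seq V -> l.-tuple V -> R) :
      (forall f s u, F f s u <= M) ->
      chain_mean K (fun f s => N * \sum_(u : l.-tuple V)
        F f s u * (~~ uniq (map (removal_time f (rev s)) u))%:R) <= M * bad.
    move=> FM; rewrite -chain_meanZ; apply: chain_mean_le => f s _ _ _.
    rewrite mulrCA ler_wpM2l // mulr_sumr; apply: ler_sum => u _.
    by rewrite ler_wpM2r.
  rewrite ler_norml; apply/andP; split.
    rewrite lerNl -mulN1r -chain_meanZ.
    rewrite (@chain_mean_eq _ _ _ _ (fun f s => N * \sum_(u : l.-tuple V)
      phi (chain_times f (rev s) u) * (~~ uniq (map (removal_time f (rev s)) u))%:R)).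
      by apply: bnd => f s u; apply: le_trans (ler_norm _) (phiM _).
    move=> f s _ _ _; rewrite mulrCA; congr (_ * _); rewrite mulr_sumr.
    by apply: eq_bigr => u _; ring.
  by apply: bnd => f s u; rewrite (le_trans (ler_norm _)) // normrN.
rewrite -(subrKA (\sum_a phi a * q a)) (le_trans (ler_normD _ _)) //.
by have := lerD h1 h2; lra.
Qed.

End Comparison.

(** * Order statistics and collisions *)

Section OrderStatistics.
Variables (R : realType) (l : nat).
Implicit Types (x y : 'I_l -> R) (i : nat).

Let values x := sort <=%R [seq x j | j <- enum 'I_l].

Let sorted_values x : sorted <=%O (values x).
Proof. exact: (sort_sorted (@le_total _ R)). Qed.

Let size_values x : size (values x) = l.
Proof. by rewrite size_sort size_map size_enum_ord. Qed.

Let count_values x (p : pred R) : count p (values x) = #|[set j | p (x j)]%SET|.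
Proof.
rewrite (permP (permEl (perm_sort _ _))) count_map -sum1_count -sum1_card.
by rewrite big_enum_cond /=; apply: eq_bigl => j; rewrite inE.
Qed.

(** At least i + 1 entries of [x] are at most its i-th order statistic, so at least i + 1 entries of
    [y] are at most that value plus [e]. *)
Lemma order_stat_le x y i (e : R) : (i < l)%N -> (forall j, y j <= x j + e) ->
  order_stat y i <= order_stat x i + e.
Proof.
move=> il yx; apply: (nth_count_le _ (sorted_values y)).
apply: (@leq_trans (count (<= order_stat x i)%O (values x))).
  rewrite ltnNge; apply/negP => h.
  have := @nth_count_gt _ _ (order_stat x i) 0 _ i (sorted_values x).
  by rewrite h size_values il -/(order_stat x i) ltxx => /(_ isT).
rewrite !count_values; apply: subset_leq_card; apply/fintype.subsetP => j.
by rewrite !inE => xj; apply: (le_trans (yx j)); rewrite lerD2r.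
Qed.

Lemma order_stat_lipschitz x y i (e : R) : (i < l)%N ->
  (forall j, `|x j - y j| <= e) -> `|order_stat x i - order_stat y i| <= e.
Proof.
move=> il xy; have h j := xy j; rewrite ler_norml; apply/andP; split.
  suff : order_stat y i <= order_stat x i + e by lra.
  by apply: order_stat_le => // j; have := h j; rewrite ler_norml => /andP[]; lra.
suff : order_stat x i <= order_stat y i + e by lra.
by apply: order_stat_le => // j; have := h j; rewrite ler_norml => /andP[]; lra.
Qed.

Lemma order_stat_nat (g : nat -> R) (t : 'I_l -> nat) i : (i < l)%N ->
  {homo g : m n / (m <= n)%N >-> m <= n} ->
  order_stat (fun j => g (t j)) i = g (nth 0%N (sort leq [seq t j | j <- enum 'I_l]) i).
Proof.
move=> il gm; rewrite -(nth_map 0%N 0 g); last first.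
  by rewrite size_sort size_map size_enum_ord.
congr nth; apply: (sorted_eq le_trans le_anti).
- exact: (sort_sorted (@le_total _ R)).
- apply: (homo_sorted (e := leq)); first exact: gm.
  exact: (sort_sorted leq_total).
- rewrite perm_sort perm_sym; apply: (perm_trans (perm_map _ (permEl (perm_sort _ _)))).
  by rewrite -map_comp.
Qed.

Lemma order_stat_itv x i : (i < l)%N -> (forall j, 0 <= x j <= 1) ->
  0 <= order_stat x i <= 1.
Proof.
move=> il x01; have : order_stat x i \in values x by rewrite mem_nth // size_values.
by rewrite mem_sort => /mapP[j _ ->].
Qed.

End OrderStatistics.

(** Only [y] is confined to the cube, since scaled times may exceed 1. The proof covers the compact
    cube by neighbourhoods on which a common radius works. *)
Lemma uniform_continuity_cube (R : realType) (m : nat) (F : 'rV[R]_m -> R) :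
  continuous F -> forall e : R, 0 < e -> exists2 r : R, 0 < r &
    forall x y : 'rV[R]_m, (forall i, 0 <= y ord0 i <= 1) ->
      (forall i, `|x ord0 i - y ord0 i| <= r) -> `|F x - F y| <= e.
Proof.
move=> cF e e0; have e2 : 0 < e / 2 by rewrite divr_gt0.
have cK := rV_compact (fun _ : 'I_m => @segment_compact R 0 1).
pose P (r : R) (y : 'rV[R]_m) :=
  forall x : 'rV[R]_m, (forall i, `|x ord0 i - y ord0 i| <= r) -> `|F x - F y| <= e.
have PE : forall y : 'rV[R]_m, \forall y' \near y & r \near 0^'+, P r y'.
  move=> y; have /cvgrPdist_lt/(_ _ e2)/nbhs_ballP[r /= r0 yr] := cF y.
  have r2 : 0 < r / 2 by rewrite divr_gt0.
  exists (ball y (r / 2), [set d | d < r / 2]) => /=.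
    by split; [exact: nbhsx_ballx|exact: nbhs_right_lt].
  move=> [y' d] /= [yy' dr] x xy'.
  have b1 : `|F y - F y'| < e / 2.
    by apply: yr; apply: le_ball yy'; lra.
  have b2 : `|F y - F x| < e / 2.
    apply: yr; split=> // i j; rewrite (ord1 i) /ball /=.
    have := yy'.2 ord0 j; rewrite /ball /= => h1; have h2 := xy' j.
    rewrite -(subrKA (y' ord0 j)) (le_lt_trans (ler_normD _ _)) //.
    by rewrite [X in _ + X]distrC (splitr r) ltr_leD // (le_trans h2) // ltW.
  rewrite -(subrKA (F y)) (le_trans (ler_normD _ _)) //.
  by rewrite [X in X + _]distrC; lra.
have /compact_near_coveringP/(_ R (0^'+) P _ (fun y _ => PE y)) h := cK.
near (0 : R)^'+ => r; exists r => // x y y01 xy.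
suff /(_ y) : [set v : 'rV[R]_m | forall i, `[0, 1]%classic (v ord0 i)] `<=` P r.
  by apply=> // i; rewrite /= in_itv /= y01.
by near: r.
Unshelve. all: by end_near. Qed.

Section Counting.
Variables (n l : nat).
Local Notation V := 'I_n.+1.

Lemma card_close (a : V) (w : nat) :
  (#|[set b : V | (a <= b + w)%N && (b <= a + w)%N]%SET| <= w.*2.+1)%N.
Proof.
rewrite -[leqRHS]card_ord.
pose g (b : V) : 'I_(w.*2.+1) := inord (b + w - a).
rewrite -(card_in_imset (f := g)); first exact: max_card.
move=> b c; rewrite !inE => /andP[b1 b2] /andP[c1 c2] /(congr1 val).
rewrite /g /= !inordK; [|lia|lia] => e.
by apply: val_inj => /=; lia.
Qed.

(** Given coordinate [i], at most 2 w + 1 of the n + 1 values of coordinate [j] are close to it. *)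
Lemma sum_pair_close (R : realFieldType) (w : nat) (i j : 'I_l) : i != j ->
  \sum_(u : l.-tuple V)
    ((tnth u i <= tnth u j + w)%N && (tnth u j <= tnth u i + w)%N)%:R
  <= (w.*2.+1)%:R / n.+1%:R * n.+1%:R ^+ l :> R.
Proof.
move=> ij.
have tfE (G : (l.-tuple V) -> R) :
    \sum_(u : l.-tuple V) G u = \sum_(r : {ffun 'I_l -> V}) G [tuple r k | k < l].
  rewrite (reindex (fun r : {ffun 'I_l -> V} => [tuple r k | k < l])) //.
  exists (fun u : l.-tuple V => [ffun k => tnth u k]) => [r|u] _.
    by apply/ffunP => k; rewrite ffunE tnth_mktuple.
  by apply: eq_from_tnth => k; rewrite tnth_mktuple ffunE.
rewrite tfE; pose close (a b : V) := (a <= b + w)%N && (b <= a + w)%N.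
(* Summing over the value [a] of coordinate [i] turns the indicator into a product over the
   coordinates, so that sum and product can be exchanged. *)
pose Gf (a : V) (k : 'I_l) (b : V) : R :=
  if k == i then (b == a)%:R else if k == j then (close a b)%:R else 1.
have ji : j != i by rewrite eq_sym.
have -> : \sum_(r : {ffun 'I_l -> V}) ((tnth [tuple r k | k < l] i
    <= tnth [tuple r k | k < l] j + w)%N && (tnth [tuple r k | k < l] j <=
    tnth [tuple r k | k < l] i + w)%N)%:R
  = \sum_(a : V) \sum_(r : {ffun 'I_l -> V}) \prod_k Gf a k (r k).
  rewrite exchange_big /=; apply: eq_bigr => r _; rewrite !tnth_mktuple.
  have prodE a : \prod_k Gf a k (r k) = (r i == a)%:R * (close a (r j))%:R.
    rewrite (bigD1 i) //= (bigD1 j) //= /Gf eqxx (negbTE ji) eqxx big1 ?mulr1 //.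
    by move=> k /andP[/negbTE -> /negbTE ->].
  rewrite (bigD1 (r i)) //= prodE eqxx mul1r big1 ?addr0 // => a ai.
  by rewrite prodE eq_sym (negbTE ai) mul0r.
have l2 : (2 <= l)%N.
  by have := ltn_ord i; have := ltn_ord j; have : (i : nat) != j by []; lia.
have lE : l = (l - 2).+2 by lia.
apply: (@le_trans _ _ (\sum_(a : V) (w.*2.+1)%:R * n.+1%:R ^+ (l - 2))); last first.
  rewrite sumr_const card_ord -[_ *+ n.+1]mulr_natl {2}lE !exprS.
  have : n.+1%:R != 0 :> R by rewrite pnatr_eq0.
  move: (n.+1%:R : R) (w.*2.+1%:R : R) (l - 2)%N => x y k x0.
  by rewrite le_eqVlt; apply/orP; left; apply/eqP; field.
apply: ler_sum => a _; rewrite -bigA_distr_bigA /=.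
rewrite (bigD1 i) //= (bigD1 j) //= /Gf eqxx (negbTE ji) eqxx.
rewrite (bigD1 a) //= eqxx big1 ?addr0 ?mul1r; last by move=> b /negbTE ->.
rewrite ler_pM ?sumr_ge0 ?prodr_ge0 //.
- by move=> k _; apply: sumr_ge0 => b _; case: ifP => // _; case: ifP.
- rewrite -natr_sum ler_nat; apply: leq_trans (card_close a w).
  rewrite -sum1_card [leqRHS]big_mkcond /=; apply: leq_sum => b _.
  by rewrite inE /close; case: (_ && _).
- rewrite (eq_bigr (fun=> n.+1%:R)) => [|k /andP[/negbTE -> /negbTE ->]]; last first.
    by rewrite sumr_const card_ord.
  rewrite prodr_const (_ : #|_| = (l - 2)%N) //.
  have := cardC (pred2 i j); rewrite card2 ij card_ord => E.
  rewrite -[in RHS]E addKn; apply: eq_card => k.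
  by rewrite !inE /= negb_or.
Qed.

End Counting.

(** * The estimate for a fixed size *)

Section ChainEstimate.
Variables (R : realType) (n l N : nat).
Hypothesis hl : (2 <= l)%N.
Local Notation V := 'I_n.+1.
Local Notation L := (ln (n%:R : R)).
Hypothesis N0 : (0 < N)%N.
Hypothesis n0 : (0 < n)%N.
Hypothesis L_ge : 4 * N%:R * (1 + ln N%:R) <= L.
Hypothesis L_le : 1 + L <= n%:R / (2 * N%:R).
Local Notation K := (grid R n N N).

Variables (F : 'rV[R]_l.-1 -> R) (M e r : R).
Hypothesis FM : forall x, `|F x| <= M.
Hypothesis e0 : 0 <= e.
Hypothesis Fr : forall x y : 'rV[R]_l.-1, (forall i, 0 <= y ord0 i <= 1) ->
  (forall i, `|x ord0 i - y ord0 i| <= r) -> `|F x - F y| <= e.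
Hypothesis Nr : 5 / N%:R <= r.

Implicit Types (f : {ffun V -> V}) (s : seq V) (u : l.-tuple V).

Definition scaled_row (a : {ffun 'I_l.-1 -> 'I_n.+2}) : 'rV[R]_l.-1 :=
  \row_i (L / n%:R * (a i)%:R).

Definition uniform_row u : 'rV[R]_l.-1 :=
  \row_i order_stat (fun j => (tnth u j)%:R / n.+1%:R) i.

Definition uniform_average : R :=
  n.+1%:R ^- l * \sum_(u : l.-tuple V) F (uniform_row u).

Let close f s := [forall v, `|scaled_time R s f v - scaled_rank R s f v| <= 5 / N%:R].

Let npos : 0 < n%:R :> R. Proof. by rewrite ltr0n. Qed.
Let Npos : 0 < N%:R :> R. Proof. by rewrite ltr0n. Qed.
Let M0 : 0 <= M. Proof. by apply: le_trans (FM 0). Qed.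
Let Kn : (K <= n)%N. Proof. exact: grid_le_n. Qed.
Let L0 : 0 <= L. Proof. by rewrite ln_ge0 // ler1n. Qed.
Let il (i : 'I_l.-1) : (i < l)%N. Proof. by have := ltn_ord i; lia. Qed.

Let Nn : N%:R <= n%:R :> R.
Proof.
have N1 : 1 <= N%:R :> R by rewrite ler1n.
move: L_le; rewrite ler_pdivlMr ?mulr_gt0 // => h.
by apply: le_trans h; have := L0; nra.
Qed.

Lemma sum_map_tuple (G : l.-tuple V -> R) (rho : V -> V) : injective rho ->
  \sum_u G (map_tuple rho u) = \sum_u G u.
Proof.
move=> rho_inj; rewrite [RHS](reindex (map_tuple rho)) //=.
apply/onW_bij/injF_bij => u v /(congr1 val) /= /(inj_map rho_inj) uv.
exact: val_inj.
Qed.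

Lemma scaled_row_times f s u : size s = K ->
  scaled_row (chain_times f (rev s) u)
  = \row_i order_stat (fun j => scaled_time R s f (tnth u j)) i.
Proof.
move=> ss; apply/rowP => i; rewrite !mxE ffunE inordK; last first.
  rewrite !ltnS; apply: leq_trans (sorted_times_le _ _ _ (il i)) _.
  by rewrite size_rev ss.
rewrite (order_stat_nat (g := fun m => m.+1%:R * L / n%:R)
  (fun j => removal_time f (rev s) (tnth u j)) (il i)); last first.
  by move=> a b ab; rewrite ler_pM2r ?invr_gt0 // ler_wpM2r // ler_nat.
rewrite /sorted_times -{1}(map_tnth_enum u) -map_comp.
by rewrite mulrC mulrA.
Qed.

Lemma uniform_row_rank f s u :
  uniform_row (map_tuple (rank_ord (removal_time f (rev s))) u)
  = \row_i order_stat (fun j => scaled_rank R s f (tnth u j)) i.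
Proof.
apply/rowP => i; rewrite !mxE; congr order_stat; apply/funext => j.
by rewrite tnth_map.
Qed.

Lemma close_sum f s : size s = K -> close f s ->
  `|\sum_(u : l.-tuple V) F (scaled_row (chain_times f (rev s) u))
    - \sum_(u : l.-tuple V) F (uniform_row u)| <= n.+1%:R ^+ l * e.
Proof.
move=> ss /forallP cfs.
rewrite -(sum_map_tuple (fun u => F (uniform_row u)) (rank_ord_inj (t := removal_time f (rev s)))).
rewrite -sumrB (le_trans (ler_norm_sum _ _ _)) //.
have -> : n.+1%:R ^+ l * e = \sum_(u : l.-tuple V) e.
  by rewrite sumr_const card_tuple card_ord -[RHS]mulr_natl natrX.
apply: ler_sum => u _; apply: Fr => i.
  rewrite uniform_row_rank mxE; apply: order_stat_itv; first exact: il.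
  move=> j; rewrite /scaled_rank divr_ge0 //= ler_pdivrMr // mul1r ler_nat.
  exact/ltnW/rank_lt.
rewrite scaled_row_times // uniform_row_rank !mxE.
apply: order_stat_lipschitz; first exact: il.
by move=> j; exact: le_trans (cfs _) Nr.
Qed.

(** Vertices with equal removal times have scaled ranks within 10 / N. Each of the at most l^2 pairs
    is that close for a proportion (2 w + 1) / (n + 1) of the tuples, which is at most 20 / N + 1 /
    (n + 1) and hence at most 21 / N. *)
Lemma close_collisions f s : close f s ->
  \sum_(u : l.-tuple V) (~~ uniq (map (removal_time f (rev s)) u))%:R
  <= n.+1%:R ^+ l * (21 * (l ^ 2)%:R / N%:R) :> R.
Proof.
move=> /forallP cfs; set t := removal_time f (rev s) in cfs *.
pose w := Num.truncn (10 * n.+1%:R / N%:R : R).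
pose near_pair (u : l.-tuple V) i j : bool :=
  (tnth u i <= tnth u j + w)%N && (tnth u j <= tnth u i + w)%N.
have n1 : 0 < n.+1%:R :> R by [].
have wP : w%:R <= 10 * n.+1%:R / N%:R :> R.
  by rewrite truncn_le // divr_ge0 ?mulr_ge0.
have rank_near v v' : t v = t v' -> (rank t v <= rank t v' + w)%N.
  move=> tE; have := cfs v; have := cfs v'.
  have -> : scaled_time R s f v = scaled_time R s f v'.
    by rewrite /scaled_time -/t tE.
  rewrite /scaled_rank -/t; move: (scaled_time R s f v') => x.
  rewrite !ler_norml => /andP[a1 a2] /andP[b1 b2].
  have h : (rank t v)%:R / n.+1%:R - (rank t v')%:R / n.+1%:R <= 10 / N%:R :> R.
    move: a1 a2 b1 b2; move: (_ / n.+1%:R) (_ / n.+1%:R) => y z a1 a2 b1 b2; lra.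
  rewrite -leq_subLR /w truncn_ge_nat ?divr_ge0 ?mulr_ge0 //.
  have [le_vv'|lt_vv'] := leqP (rank t v) (rank t v').
    by rewrite (eqP (_ : _ - _ == 0)%N) ?divr_ge0 ?mulr_ge0 // subn_eq0.
  rewrite natrB ?(ltnW lt_vv') // mulrAC -ler_pdivrMr // mulrBl.
  exact: h.
have sub u : (~~ uniq (map t u))%:R <= \sum_(p : 'I_l * 'I_l | p.1 != p.2)
    (near_pair (map_tuple (rank_ord t) u) p.1 p.2)%:R :> R.
  have [_|uu] := boolP (uniq (map t u)); first exact: sumr_ge0.
  have [i [j [ij tij]]] : exists i j : 'I_l, i != j /\ t (tnth u i) = t (tnth u j).
    apply/not_existsP => h; case/negP: uu.
    rewrite -(map_tnth_enum u) -map_comp map_inj_uniq ?enum_uniq // => i j tij.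
    by apply/eqP; apply: contraT => ij; case: (h i); exists j.
  rewrite (bigD1 (i, j)) //= /near_pair !tnth_map /=.
  by rewrite !rank_near // lerDl sumr_ge0.
apply: le_trans (ler_sum _ (fun u _ => sub u)) _.
rewrite exchange_big /=.
have -> : n.+1%:R ^+ l * (21 * (l ^ 2)%:R / N%:R)
   = \sum_(p : 'I_l * 'I_l) n.+1%:R ^+ l * (21 / N%:R) :> R.
  rewrite sumr_const card_prod card_ord -[RHS]mulr_natl.
  by rewrite (mulnn l); field; rewrite lt0r_neq0.
rewrite [leRHS](bigID (fun p : 'I_l * 'I_l => p.1 != p.2)) /=.
apply: le_trans (_ : _ <= \sum_(p : 'I_l * 'I_l | p.1 != p.2) n.+1%:R ^+ l * (21 / N%:R)) _;
  last by rewrite lerDl sumr_ge0 // => p _; rewrite !mulr_ge0 ?exprn_ge0 ?invr_ge0.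
apply: ler_sum => -[i j] /= ij.
rewrite (sum_map_tuple (fun u => (near_pair u i j)%:R) (rank_ord_inj (t := t))).
apply: (le_trans (sum_pair_close n R w ij)).
rewrite [leRHS]mulrC ler_wpM2r ?exprn_ge0 // ler_pdivrMr //.
rewrite -addn1 natrD -mul2n natrM.
have -> : 21 / N%:R * n.+1%:R = 2 * (10 * n.+1%:R / N%:R) + n.+1%:R / N%:R :> R.
  by field; rewrite lt0r_neq0.
rewrite lerD ?ler_wpM2l // ler_pdivlMr // mul1r.
by apply: (le_trans Nn); rewrite ler_nat.
Qed.

Let far : R := chain_mean K (fun f s => (~~ close f s)%R%:R).

Lemma chain_collisions : chain_mean K (fun f s => n.+1%:R ^- l *
    \sum_(u : l.-tuple V) (~~ uniq (map (removal_time f (rev s)) u))%:R)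
  <= 21 * (l ^ 2)%:R / N%:R + far.
Proof.
have q0 : 0 < n.+1%:R ^+ l :> R by rewrite exprn_gt0.
rewrite -(chain_mean_cst n K (21 * (l ^ 2)%:R / N%:R)) -chain_meanD.
apply: chain_mean_le => f s pf ss _; rewrite mulrC ler_pdivrMr //.
have c0 : 0 <= 21 * (l ^ 2)%:R / N%:R :> R by rewrite divr_ge0 ?mulr_ge0.
have [cfs|_] := boolP (close f s).
  by rewrite addr0 mulrC; exact: close_collisions.
apply: (@le_trans _ _ (\sum_(u : l.-tuple V) 1)).
  by apply: ler_sum => u _; case: uniq.
rewrite sumr_const card_tuple card_ord [leLHS]natrX ler_peMl ?(ltW q0) //.
by rewrite -[leLHS]add0r lerD.
Qed.

Lemma chain_average : `|chain_mean K (fun f s => n.+1%:R ^- l *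
    \sum_(u : l.-tuple V) F (scaled_row (chain_times f (rev s) u))) - uniform_average|
  <= e + 2 * M * far.
Proof.
have q0 : 0 < n.+1%:R ^+ l :> R by rewrite exprn_gt0.
have cmp f s : size s = K ->
    `|n.+1%:R ^- l * \sum_(u : l.-tuple V) F (scaled_row (chain_times f (rev s) u))
      - uniform_average| <= e + 2 * M * (~~ close f s)%R%:R.
  move=> ss; rewrite /uniform_average -mulrBr normrM ger0_norm ?invr_ge0 ?(ltW q0) //.
  rewrite mulrC ler_pdivrMr // [leRHS]mulrC.
  have [cfs|_] := boolP (close f s); first by rewrite mulr0 addr0 close_sum.
  rewrite -sumrB (le_trans (ler_norm_sum _ _ _)) //.
  apply: (@le_trans _ _ (\sum_(u : l.-tuple V) (M + M))).
    by apply: ler_sum => u _; rewrite (le_trans (ler_normB _ _)) // lerD.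
  rewrite sumr_const card_tuple card_ord -[leLHS]mulr_natl natrX ler_wpM2l ?(ltW q0) //.
  by rewrite -[leLHS]add0r lerD // mulr1 mulr_natl.
have both (G : {ffun V -> V} -> seq V -> R) :
   (forall f s, size s = K -> G f s <= e + 2 * M * (~~ close f s)%R%:R) ->
   chain_mean K G <= e + 2 * M * far.
  move=> GE; rewrite -chain_meanZ -{1}(chain_mean_cst n K e) -chain_meanD.
  by apply: chain_mean_le => f s _ ss _; exact: GE.
rewrite -(chain_mean_cst n K uniform_average) ler_norml; apply/andP; split.
  rewrite lerNl opprB -[X in _ - X]mul1r -mulNr -chain_meanZ -chain_meanD.
  apply: both => f s ss; have := cmp f s ss; rewrite mulN1r distrC.
  exact/le_trans/ler_norm.
rewrite -[X in _ - X]mul1r -mulNr -chain_meanZ -chain_meanD.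
apply: both => f s ss; have := cmp f s ss; rewrite mulN1r.
exact/le_trans/ler_norm.
Qed.

(** The comparison of laws contributes 2 M times the collision probability, and the passage from
    times to ranks contributes e + 2 M times the probability that they are far apart. *)
Lemma process_average d (Omega : measurableType d) (P : probability Omega R)
    (T : Omega -> {set {set V}}) (U : Omega -> l.-tuple V)
    (C : nat -> Omega -> {set V}) : disconnection P T U C ->
  exists2 m : R,
    ('E_P[fun w => F (\row_(i < l.-1) (ln n%:R / n%:R *
      (disconnection_time (T w) (U w) (fun k => C k w) i.+2)%:R)%R)] = m%:E)%E &
    `|m - uniform_average|
      <= e + 42 * M * (l ^ 2)%:R / N%:R
         + 4 * M * (32 * N%:R ^+ 2 * N.+1%:R / L).
Proof.
move=> D; pose phi (a : {ffun 'I_l.-1 -> 'I_n.+2}) := F (scaled_row a).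
exists (\sum_y phi (times_of y) * pmf P (joint T U C) y).
  rewrite -(expectation_finite P (measurable_joint D)); congr expectation.
  apply/funext => w; congr F; apply/rowP => i; rewrite !mxE ffunE inordK; last first.
    rewrite ltnS /disconnection_time (leq_trans (find_size _ _)) //.
    by rewrite size_iota.
  congr (_ * _%:R); rewrite /disconnection_time; apply: eq_in_find => k.
  (* The search uses prefixes of length at most [n], on which the recorded tuple agrees with [C]. *)
  rewrite mem_iota add0n ltnS => /andP[_ kn].
  congr (spread _ _ _ == _); apply: (@eq_from_nth _ finset.set0) => [|j].
    by rewrite !size_mkseq.
  rewrite size_mkseq => jk; rewrite !nth_mkseq //.
  exact: leq_trans jk kn.
have := law_comparison hl D Kn (fun a => FM (scaled_row a)).
have := chain_average; have := chain_collisions.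
have := @scaled_time_rank_prob R n N N0 n0 L_ge L_le.
rewrite -/far; set A := chain_mean K _; set B := chain_mean K _.
set S := \sum_y _; set p := _ / L => h1 h2 h3 h4.
rewrite -(subrKA B) (le_trans (ler_normD _ _)) //.
have M2 : 0 <= 2 * M by rewrite mulr_ge0.
have h5 : 2 * M * A <= 2 * M * (21 * (l ^ 2)%:R / N%:R + p).
  by rewrite ler_wpM2l // (le_trans h2) // lerD2l.
have h6 : 2 * M * far <= 2 * M * p by rewrite ler_wpM2l.
by apply: (le_trans (lerD (le_trans h4 h5) (le_trans h3 (_ : _ <= e + 2 * M * p)))); lra.
Qed.

End ChainEstimate.

(** * The uniform limit *)

Lemma uniform_prob_itv (R : realType) (a b : R) : 0 <= a -> a < b -> b <= 1 ->
  uniform_prob (@ltr01 R) `[a, b[%classic = (b - a)%:E.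
Proof.
move=> a0 ab b1; rewrite /uniform_prob (eq_integral (cst 1%E)); last first.
  move=> x; rewrite inE /= in_itv /= => /andP[ax xb].
  by rewrite /uniform_pdf (le_trans a0 ax) (le_trans (ltW xb) b1) subr0 invr1.
by rewrite integral_cst //= lebesgue_measure_itv /= lte_fin ab mul1e EFinB.
Qed.

Section Discretization.
Context d (Omega : measurableType d) (R : realType) (P : probability Omega R).
Variables (l : nat) (V : 'I_l -> {RV P >-> R}).
Variables (m : nat) (a b : R).

(* The shift [b] lets the cells cover negative values of [V j w]. *)
Definition cell (x : R) : nat := Num.truncn (a * x + b).

Definition cells (w : Omega) : l.-tuple 'I_m.+1 := [tuple inord (cell (V j w)) | j < l].

Lemma measurable_cell k j : measurable [set w | cell (V j w) = k].
Proof.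
have mf : measurable_fun setT (fun w => a * V j w + b).
  by apply: measurable_funD => //; apply: measurable_funM => //; exact: measurable_funP.
(* Negative numbers are truncated to 0, so the cell 0 is unbounded below. *)
have cellE w : (cell (V j w) == k) = ((k == 0%N) || (k%:R <= a * V j w + b))
     && (a * V j w + b < k.+1%:R).
  have [k0|k0] /= := eqVneq k 0%N.
    by rewrite /cell -truncn_le_nat k0 leqn0.
  rewrite eqn_leq [X in X && _]truncn_le_nat andbC; congr (_ && _).
  by case: k k0 => // k _; rewrite truncn_gt_nat.
rewrite (_ : [set _ | _] =
    (if k == 0%N then setT else (fun w => a * V j w + b) @^-1` `[k%:R, +oo[%classic)
    `&` (fun w => a * V j w + b) @^-1` `]-oo, k.+1%:R[%classic).
  apply: measurableI; last by rewrite -[X in measurable X]setTI; exact: mf.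
  by case: ifP => // _; rewrite -[X in measurable X]setTI; exact: mf.
apply/seteqP; split => w /=.
  move=> /eqP; rewrite cellE => /andP[h1 h2]; split; last by rewrite in_itv.
  by case: ifP h1 => //= _; rewrite in_itv /= andbT.
move=> [h1]; rewrite in_itv /= => h2; apply/eqP; rewrite cellE h2 andbT.
by case: ifP h1 => //= _; rewrite in_itv /= andbT.
Qed.

Lemma measurable_cells : discrete_rv cells.
Proof.
move=> u; rewrite (_ : _ @^-1` _ = \bigcap_(j in [set: 'I_l])
  \bigcup_(k in [set k | inord k = tnth u j]) [set w | cell (V j w) = k]).
  apply: fin_bigcap_measurable => // j _.
  by apply: bigcup_measurable => k _; exact: measurable_cell.
apply/seteqP; split => w /=.
  by move=> <- j _; exists (cell (V j w)) => //=; rewrite tnth_mktuple.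
move=> h; apply: eq_from_tnth => j; rewrite tnth_mktuple.
by have [k /= <- ->] := h j I.
Qed.

End Discretization.

Section UniformLimit.
Context d (Omega : measurableType d) (R : realType) (P : probability Omega R).
Variables (l : nat) (V : 'I_l -> {RV P >-> R}).
Hypothesis hl : (2 <= l)%N.
Hypothesis hV : iid_uniform01 V.
Variables (F : 'rV[R]_l.-1 -> R) (M : R).
Hypothesis cF : continuous F.
Hypothesis FM : forall x, `|F x| <= M.

Let Y (w : Omega) : 'rV[R]_l.-1 := \row_i order_stat (fun j => V j w) i.

Let il (i : 'I_l.-1) : (i < l)%N. Proof. by have := ltn_ord i; lia. Qed.

Lemma order_stat_cvg (x : nat -> 'I_l -> R) (y : 'I_l -> R) :
  (\forall n \near \oo, forall j, `|x n j - y j| <= n.+1%:R^-1) ->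
  F (\row_i order_stat (x n) i) @[n --> \oo] --> F (\row_i order_stat y i).
Proof.
move=> xy; apply: continuous_cvg; first exact: cF.
apply/cvg_ballP => e e0; near=> n.
split=> // i j; rewrite /ball /= !mxE distrC.
apply: (@le_lt_trans _ _ n.+1%:R^-1).
  apply: order_stat_lipschitz; first exact: il.
  by near: n.
near: n; exact: near_infty_natSinv_lt (PosNum e0).
Unshelve. all: by end_near. Qed.

Let cells_close (n : nat) (b x : R) : 0 <= n.+1%:R * x + b ->
  `|((cell n.+1%:R b x)%:R - b) / n.+1%:R - x| <= n.+1%:R^-1.
Proof.
move=> h; have := truncn_itv h; rewrite -/(cell _ _ _).
rewrite -[(cell _ _ _).+1%:R]natr1 => /andP[h1 h2].
have n0 : 0 < n.+1%:R :> R by [].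
have -> : ((cell n.+1%:R b x)%:R - b) / n.+1%:R - x
    = ((cell n.+1%:R b x)%:R - (n.+1%:R * x + b)) / n.+1%:R.
  by field; rewrite lt0r_neq0.
rewrite normrM [X in _ * X]ger0_norm ?invr_ge0 ?(ltW n0) //.
rewrite -[leRHS]mul1r ler_pM2r ?invr_gt0 // ler_norml; apply/andP; split; lra.
Qed.

Lemma measurable_order_stat : measurable_fun setT (F \o Y).
Proof.
(* As soon as every [V j w] is at most n + 1 in absolute value, this shift makes the truncated
   quantities nonnegative and at most 2 (n + 1)^2, which is within the range of [m n]. *)
pose b n : R := n.+1%:R ^+ 2.
pose m n : nat := (n.+1 ^ 2).*2.+1.
pose g n (u : l.-tuple 'I_(m n).+1) :=
  F (\row_i order_stat (fun j => ((tnth u j)%:R - b n) / n.+1%:R) i).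
apply: (@measurable_fun_cvg _ _ _ _ (fun n => g n \o cells V (m n) n.+1%:R (b n))).
  by move=> n; apply: measurable_fun_finite; exact: measurable_cells.
move=> w _; apply: order_stat_cvg; near=> n.
have n0 : 0 < n.+1%:R :> R by [].
have Vn : forall j, `|V j w| <= n.+1%:R.
  near: n; apply: filter_forall => j'.
  have := nbhs_infty_ger `|V j' w|; apply: filterS => k kV.
  by apply: (le_trans kV); rewrite ler_nat.
move=> j; have := Vn j; rewrite ler_norml => /andP[V1 V2].
have c0 : 0 <= n.+1%:R * V j w + b n by rewrite /b; nra.
rewrite tnth_mktuple inordK; first exact: cells_close.
have mE : (m n).+1%:R = 2 * n.+1%:R ^+ 2 + 2 :> R.
  by rewrite /m -addn2 natrD -mul2n natrM natrX.
by rewrite ltnS truncn_le_nat mE /b; nra.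
Unshelve. all: by end_near. Qed.

Let in01 j (w : Omega) := 0 <= V j w < 1.

Let ae_in01 : {ae P, forall w, forall j, in01 j w}.
Proof.
apply: filter_forall => j.
exists (~` (V j @^-1` `[0, 1[%classic)); split.
- by apply: measurableC; rewrite -[X in measurable X]setTI; exact: measurable_funP.
- rewrite probability_setC; last first.
    by rewrite -[X in measurable X]setTI; exact: measurable_funP.
  have := hV.2 j `[0, 1[%classic (measurable_itv _).
  rewrite uniform_prob_itv // subr0 /distribution /pushforward => ->.
  by rewrite subee.
- by move=> w /= h; rewrite in_itv.
Qed.

(* Independence yields the lower bound, and the total mass forces equality. *)
Lemma cells_law n (u : l.-tuple 'I_n.+1) :
  pmf P (cells V n n.+1%:R 0) u = n.+1%:R ^- l.
Proof.
pose p := pmf P (cells V n n.+1%:R 0).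
have n0 : 0 < n.+1%:R :> R by [].
have mc := measurable_cells (m := n) V n.+1%:R 0.
have low u' : n.+1%:R ^- l <= p u'.
  pose B j := `[(tnth u' j)%:R / n.+1%:R, (tnth u' j).+1%:R / n.+1%:R[%classic : set R.
  have mB j : measurable (B j) by exact: measurable_itv.
  have PB j : P (V j @^-1` B j) = (n.+1%:R^-1)%:E.
    have := hV.2 j (B j) (mB j); rewrite /distribution /pushforward => ->.
    rewrite uniform_prob_itv ?divr_ge0 //.
    + by congr EFin; rewrite -mulrBl -natr1 addrAC subrr add0r mul1r.
    + by rewrite ltr_pM2r ?invr_gt0 // ltr_nat.
    + by rewrite ler_pdivrMr // mul1r ler_nat.
  have := hV.1 [set: 'I_l]%SET B mB.
  under eq_bigr do rewrite PB.
  rewrite prodEFin prodr_const cardsT card_ord exprVn => PE.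
  rewrite -lee_fin -PE /p /pmf fineK; last by apply: fin_num_measure; exact: mc.
  apply: le_measure; rewrite ?inE.
  - apply: fin_bigcap_measurable => // j _.
    by rewrite -[X in measurable X]setTI; exact: measurable_funP.
  - exact: mc.
  move=> w h /=; apply: eq_from_tnth => j; rewrite tnth_mktuple.
  have /= := h j; rewrite inE => /(_ isT); rewrite /B /= in_itv /=.
  rewrite ler_pdivrMr // ltr_pdivlMr // => /andP[h1 h2].
  apply: val_inj => /=; rewrite (_ : cell _ _ _ = tnth u' j) ?inordK //.
  by apply/eqP; rewrite truncn_eq ?addr0 mulrC ?h1 //; apply: le_trans h1.
apply/eqP; rewrite eq_le low andbT leNgt; apply/negP => lt_u.
have S1 : \sum_(u' : l.-tuple 'I_n.+1) n.+1%:R ^- l = 1 :> R.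
  by rewrite sumr_const card_tuple card_ord -[LHS]mulr_natr natrX mulVf ?expf_neq0 ?pnatr_eq0.
have : \sum_(u' : l.-tuple 'I_n.+1) n.+1%:R ^- l < \sum_u' p u'.
  rewrite (bigD1 u) //= [ltRHS](bigD1 u) //= ltr_leD //.
  by apply: ler_sum => u' _; exact: low.
by rewrite S1 (sum_pmf P mc) ltxx.
Qed.

(** Uniform variables rounded down to multiples of 1 / (n + 1) are exactly uniform on the grid, so
    [uniform_average n F] is an expectation on [Omega] and dominated convergence applies. *)
Lemma uniform_average_cvg :
  ('E_P[F \o Y] \is a fin_num)%E /\
  (uniform_average n F)%:E @[n --> \oo] --> ('E_P[F \o Y])%E.
Proof.
pose g n (u : l.-tuple 'I_n.+1) := F (uniform_row R u).
have gE n : ((uniform_average n F)%:E = 'E_P[g n \o cells V n n.+1%:R 0])%E.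
  rewrite (expectation_finite _ (measurable_cells (m := n) V n.+1%:R 0)); congr EFin.
  by rewrite /uniform_average mulr_sumr; apply: eq_bigr => u _; rewrite cells_law mulrC.
have mg n : measurable_fun setT (EFin \o (g n \o cells V n n.+1%:R 0)).
  apply/measurable_EFinP/measurable_fun_finite; exact: measurable_cells.
have mFY : measurable_fun setT (EFin \o (F \o Y)).
  by apply/measurable_EFinP; exact: measurable_order_stat.
have gF : {ae P, forall w, [set: Omega] w ->
    (EFin \o (g n \o cells V n n.+1%:R 0)) w @[n --> \oo] --> (EFin \o (F \o Y)) w}.
  apply: filterS ae_in01 => w w01 _; apply: cvg_EFin; first exact: nearW.
  apply: order_stat_cvg; apply: nearW => n j.
  have /andP[V0 V1] := w01 j; have n0 : 0 < n.+1%:R :> R by [].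
  rewrite tnth_mktuple inordK; last first.
    by rewrite /cell addr0 truncn_lt_nat ?mulr_ge0 // gtr_pMr.
  have := @cells_close n 0 (V j w); rewrite subr0 addr0; apply.
  by rewrite mulr_ge0.
have iM : P.-integrable setT (EFin \o cst M).
  exact: finite_measure_integrable_cst.
have gM : {ae P, forall w n, [set: Omega] w ->
    (`|(EFin \o (g n \o cells V n n.+1%:R 0)) w| <= (EFin \o cst M) w)%E}.
  by apply: aeW => w n _; rewrite /= lee_fin; exact: FM.
have [iF _ cvgF] := dominated_convergence measurableT mg mFY gF iM gM.
split; first by rewrite unlock; exact: integrable_fin_num.
under eq_cvg do rewrite gE unlock.
by rewrite unlock.
Qed.

End UniformLimit.

Lemma ln_nat_large (R : realType) (B : R) : \forall n \near \oo, B <= ln n%:R.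
Proof.
have := nbhs_infty_ger (expR B); apply: filterS => n nB.
rewrite -[leLHS]expRK ler_ln ?posrE ?expR_gt0 //.
exact: lt_le_trans (expR_gt0 B) nB.
Qed.

(** Here n = exp (L / 2)^2 is at least (1 + L / 2)^2, while 2 N is at most L / 4. *)
Lemma ln_nat_small (R : realType) (N n : nat) : (0 < N)%N -> (0 < n)%N ->
  8 * N%:R <= ln (n%:R : R) -> 1 + ln (n%:R : R) <= n%:R / (2 * N%:R).
Proof.
move=> N0 n0 hL; set L := ln _ in hL *.
have Npos : 0 < N%:R :> R by rewrite ltr0n.
have npos : 0 < n%:R :> R by rewrite ltr0n.
have -> : n%:R = expR (L / 2) * expR (L / 2).
  by rewrite -expRD -splitr lnK.
have := expR_ge1Dx (L / 2); move: (expR _) => x x1.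
rewrite ler_pdivlMr ?mulr_gt0 //.
have : (1 + L / 2) * (1 + L / 2) <= x * x by rewrite ler_pM //; lra.
nra.
Qed.

Theorem corollary5 (R : realType) (l : nat) (hl : (2 <= l)%N)
    (d : nat -> measure_display) (Omega : forall n, measurableType (d n))
    (P : forall n, probability (Omega n) R)
    (T : forall n, Omega n -> {set {set 'I_n.+1}})
    (U : forall n, Omega n -> l.-tuple 'I_n.+1)
    (C : forall n, nat -> Omega n -> {set 'I_n.+1})
    (hTUC : forall n, (l.-1 <= n)%N ->
      disconnection (P n) (T n) (U n) (C n))
    (d' : measure_display) (Omega' : measurableType d')
    (P' : probability Omega' R) (V : 'I_l -> {RV P' >-> R})
    (hV : iid_uniform01 V) :
  cvg_in_distribution P
    (fun n w => \row_(i < l.-1)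
      (ln n%:R / n%:R *
        (disconnection_time (T n w) (U n w) (fun k => C n k w) i.+2)%:R) : 'rV[R]_l.-1)
    P'
    (fun w => \row_(i < l.-1) order_stat (fun j => V j w) i : 'rV[R]_l.-1).
Proof.
move=> F cF [M FM].
have [finE cvgA] := uniform_average_cvg hl hV cF FM.
have M0 : 0 <= M by apply: le_trans (FM 0).
set E' := expectation P' _ in finE cvgA *.
have {}cvgA : uniform_average n F @[n --> \oo] --> fine E'.
  by apply: (fine_cvg (f := fun n => (uniform_average n F)%:E)); rewrite fineK.
have near_average (e : R) : 0 < e -> \forall n \near \oo,
    exists2 m : R, ('E_(P n)[F \o (fun w => \row_(i < l.-1) (ln n%:R / n%:R *
      (disconnection_time (T n w) (U n w) (fun k => C n k w) i.+2)%:R)%R)] = m%:E)%E &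
    `|m - uniform_average n F| <= e.
  move=> e0; have e3 : 0 < e / 3 by rewrite divr_gt0.
  have [r r0 Fr] := uniform_continuity_cube cF e3.
  (* Taking [N] above [q] makes the mesh error 5 / N at most [r] and the collision term at most e /
     3; [n] is then taken large for this fixed [N]. *)
  pose q : R := 5 / r + 42 * M * (l ^ 2)%:R / (e / 3).
  pose N := (Num.truncn q).+1.
  have Npos : 0 < N%:R :> R by [].
  have q0 : 0 <= 42 * M * (l ^ 2)%:R / (e / 3) by rewrite divr_ge0 ?mulr_ge0 // ltW.
  have r5 : 0 < 5 / r by rewrite divr_gt0.
  have qN : q <= N%:R by apply/ltW/truncnS_gt.
  have Nr : 5 / N%:R <= r.
    rewrite ler_pdivrMr // mulrC -ler_pdivrMr //; apply: le_trans qN.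
    by rewrite lerDl.
  have NM : 42 * M * (l ^ 2)%:R / N%:R <= e / 3.
    rewrite ler_pdivrMr // [leRHS]mulrC -ler_pdivrMr //; apply: le_trans qN.
    by rewrite lerDr ltW.
  pose c : R := 4 * M * (32 * N%:R ^+ 2 * N.+1%:R).
  near=> n.
  have n0 : (0 < n)%N by near: n; exact: nbhs_infty_gt.
  have L1 : 8 * N%:R <= ln (n%:R : R) by near: n; exact: ln_nat_large.
  have L2 : 4 * N%:R * (1 + ln N%:R) <= ln (n%:R : R).
    by near: n; exact: ln_nat_large.
  have L3 : c / (e / 3) <= ln (n%:R : R) by near: n; exact: ln_nat_large.
  have L0 : 0 < ln (n%:R : R) by apply: lt_le_trans L1; rewrite mulr_gt0.
  have D : disconnection (P n) (T n) (U n) (C n).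
    by apply: hTUC; near: n; exact: nbhs_infty_ge.
  have [m mE mA] := process_average hl (ltn0Sn _ : (0 < N)%N) n0 L2
    (ln_nat_small (ltn0Sn _) n0 L1) FM (ltW e3) Fr Nr D.
  exists m; first exact: mE.
  apply: (le_trans mA).
  have cL : 4 * M * (32 * N%:R ^+ 2 * N.+1%:R / ln n%:R) <= e / 3.
    rewrite mulrA ler_pdivrMr //; move: L3; rewrite ler_pdivrMr // => L3.
    by rewrite [leRHS]mulrC.
  by move: NM cL; rewrite -/N; lra.
rewrite -(fineK finE); apply/fine_cvgP; split.
  by have := near_average 1 ltr01; apply: filterS => n [m ->].
apply/cvgrPdist_le => e e0; have e2 : 0 < e / 2 by rewrite divr_gt0.
have := near_average _ e2; have /cvgrPdist_le/(_ _ e2) := cvgA.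
apply: filterS2 => n hA [m mE mA]; rewrite /= mE /=.
rewrite -(subrKA (uniform_average n F)) (le_trans (ler_normD _ _)) //.
by rewrite [X in _ + X]distrC (splitr e) lerD.
Unshelve. all: by end_near. Qed.
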